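(* Let $R$ be an associative ring with identity, let $\mathscr{C}=R\text{-}\mathsf{mod}$ be the category of finitely presented left $R$-modules, assumed to have enough projective objects as an exact category, and let $n\ge0$ be an integer. For any finitely presented left $R$-modules $M,N$ there is an isomorphism of groups $$\mathrm{Ext}^n_{\mathscr{C}}(M,\Omega^nN)/\mathcal{P}\;\cong\;\mathrm{Nat}\big(\mathrm{Tor}_{n+1}^R(-,M),\mathrm{Tor}_{n+1}^R(-,N)\big).$$
   Context: $\mathscr{C}=R\text{-}\mathsf{mod}$ is an extension-closed subcategory of the category of all left $R$-modules, regarded as an exact category whose conflations are the short exact sequences with all terms finitely presented; having enough projectives means that every finitely presented left module $X$ admits a short exact sequence $0\to K\to P\to X\to0$ with $P$ finitely generated projective and $K$ finitely presented. $\mathrm{Ext}^n_{\mathscr{C}}$ is the Yoneda Ext of this exact category, $\mathrm{Ext}^0_{\mathscr{C}}=\mathrm{Hom}$. $\Omega^nN$ is an $n$-th syzygy of $N$, i.e. the left end of an exact sequence $0\to\Omega^nN\to P_{n-1}\to\cdots\to P_0\to N\to0$ which is a splice of conflations in $\mathscr{C}$ with each $P_i$ projective in $\mathscr{C}$ ($\Omega^0N=N$). $\mathcal{P}$ is the subgroup of $\mathrm{Ext}^n_{\mathscr{C}}(M,\Omega^nN)$ of elements of the form $f\beta$ (push-out of $\beta$ along $f$; composition if $n=0$) with $f:P\to\Omega^nN$ a morphism in $\mathscr{C}$, $P$ projective, and $\beta\in\mathrm{Ext}^n_{\mathscr{C}}(M,P)$. The functors $\mathrm{Tor}_{n+1}^R(-,M)$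 and $\mathrm{Tor}_{n+1}^R(-,N)$ are considered as functors from the category $\mathsf{mod}\text{-}R$ of finitely presented right $R$-modules to abelian groups, and $\mathrm{Nat}$ denotes the group of natural transformations. *)

(* Defs.v *)
From HB Require Import structures.
From mathcomp Require Import all_boot all_order all_algebra boolp.

Set Implicit Arguments.
Unset Strict Implicit.
Unset Printing Implicit Defensive.

Import GRing.Theory.
Local Open Scope ring_scope.
Local Open Scope quotient_scope.

(******************************************************************************)
(*  Left R-modules are [lmodType R]; right R-modules are [lmodType R^c], the  *)
(*  right action being  x . r := (r : R^c) *: x.                              *)
(******************************************************************************)

Definition im_pred (U V : zmodType) (f : U -> V) : {pred V} :=
  fun v => `[< exists u, f u = v >].

Lemma im_predP (U V : zmodType) (f : U -> V) v :
  reflect (exists u, f u = v) (v \in im_pred f).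
Proof. exact: asboolP. Qed.

Section ImAdditive.
Variables (U V : zmodType) (f : {additive U -> V}).
Fact im_zmod_closed : zmod_closed (im_pred f).
Proof.
split; first by apply/im_predP; exists 0; rewrite raddf0.
move=> _ _ /im_predP[x <-] /im_predP[y <-].
by apply/im_predP; exists (x - y); rewrite raddfB.
Qed.
HB.instance Definition _ := GRing.isZmodClosed.Build V (im_pred f) im_zmod_closed.
End ImAdditive.

Section Coker.
Variables (R : pzRingType) (U V : lmodType R) (f : {linear U -> V}).

Definition coker := Quotient.quot (im_pred f : zmodClosed V).
HB.instance Definition _ := GRing.Zmodule.on coker.

Definition coker_pi (v : V) : coker := \pi_coker v.

Lemma coker_pi_eq u v : coker_pi u = coker_pi v <-> exists w, f w = u - v.
Proof.
rewrite /coker_pi; split=> [/eqP|H].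
  by rewrite -Quotient.idealrBE => /im_predP.
by apply/eqP; rewrite -Quotient.idealrBE; apply/im_predP.
Qed.

Lemma coker_pi_surj q : exists v, coker_pi v = q.
Proof. by exists (repr q); rewrite /coker_pi reprK. Qed.

Fact coker_pi_zmod : zmod_morphism coker_pi.
Proof. by move=> x y; rewrite /coker_pi !piE. Qed.

Definition coker_scale (a : R) (q : coker) : coker := coker_pi (a *: repr q).

Lemma coker_scaleE a v : coker_scale a (coker_pi v) = coker_pi (a *: v).
Proof.
apply/coker_pi_eq.
have /coker_pi_eq[w ew] : coker_pi (repr (coker_pi v)) = coker_pi v
  by rewrite /coker_pi reprK.
by exists (a *: w); rewrite linearZ /= ew scalerBr.
Qed.

Fact coker_scaleA a b q : coker_scale a (coker_scale b q) = coker_scale (a * b) q.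
Proof. by case: (coker_pi_surj q) => v <-; rewrite !coker_scaleE scalerA. Qed.
Fact coker_scale1 : left_id 1 coker_scale.
Proof. by move=> q; case: (coker_pi_surj q) => v <-; rewrite !coker_scaleE scale1r. Qed.
Fact coker_piD x y : coker_pi (x + y) = coker_pi x + coker_pi y.
Proof. by rewrite /coker_pi !piE. Qed.
Fact coker_scaleDr : right_distributive coker_scale +%R.
Proof.
move=> a q r; case: (coker_pi_surj q) => x <-; case: (coker_pi_surj r) => y <-.
by rewrite -coker_piD !coker_scaleE scalerDr coker_piD.
Qed.
Fact coker_scaleDl q : {morph coker_scale^~ q : a b / a + b}.
Proof.
move=> a b; case: (coker_pi_surj q) => x <-.
by rewrite !coker_scaleE scalerDl coker_piD.
Qed.
HB.instance Definition _ := GRing.Zmodule_isLmodule.Build R coker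
  coker_scaleA coker_scale1 coker_scaleDr coker_scaleDl.

Fact coker_pi_scalable : scalable coker_pi.
Proof. by move=> a v; rewrite -coker_scaleE. Qed.
HB.instance Definition _ := GRing.isZmodMorphism.Build V coker coker_pi coker_pi_zmod.
HB.instance Definition _ := GRing.isScalable.Build R V coker *:%R coker_pi coker_pi_scalable.

Variables (W : lmodType R) (g : {linear V -> W}).

Definition coker_lift of (forall u, g (f u) = 0) := fun q : coker => g (repr q).

Hypothesis gf : forall u, g (f u) = 0.

Lemma coker_liftE v : coker_lift gf (coker_pi v) = g v.
Proof.
have /coker_pi_eq[w ew] : coker_pi (repr (coker_pi v)) = coker_pi v
  by rewrite /coker_pi reprK.
by apply/eqP; rewrite /coker_lift -subr_eq0 -linearB; move: (gf w) => /=; rewrite ew => ->.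
Qed.

Fact coker_lift_linear : linear (coker_lift gf).
Proof.
move=> a q r; case: (coker_pi_surj q) => x <-; case: (coker_pi_surj r) => y <-.
by rewrite -linearP !coker_liftE linearP.
Qed.
HB.instance Definition _ := GRing.isLinear.Build R coker W *:%R (coker_lift gf) coker_lift_linear.
End Coker.

Definition ker_pred (U V : zmodType) (f : U -> V) : {pred U} := fun u => f u == 0.

Section KerAdditive.
Variables (U V : zmodType) (f : {additive U -> V}).
Fact ker_zmod_closed : zmod_closed (ker_pred f).
Proof.
split; first by rewrite unfold_in raddf0.
by move=> x y; rewrite !unfold_in raddfB => /eqP-> /eqP->; rewrite subrr.
Qed.
HB.instance Definition _ := GRing.isZmodClosed.Build U (ker_pred f) ker_zmod_closed.

Definition zker := {u : U | u \in ker_pred f}.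
HB.instance Definition _ := SubChoice.on zker.
HB.instance Definition _ := [SubChoice_isSubZmodule of zker by <:].
End KerAdditive.

Section KerLinear.
Variables (R : pzRingType) (U V : lmodType R) (f : {linear U -> V}).
Fact ker_submod_closed : submod_closed (ker_pred f).
Proof.
split; first by rewrite unfold_in raddf0.
by move=> a x y; rewrite !unfold_in linearP => /eqP-> /eqP->; rewrite scaler0 addr0.
Qed.
HB.instance Definition _ := GRing.isSubmodClosed.Build R U (ker_pred f) ker_submod_closed.

Definition lker := {u : U | u \in ker_pred f}.
HB.instance Definition _ := SubChoice.on lker.
HB.instance Definition _ := [SubChoice_isSubLmodule of lker by <:].


End KerLinear.

Definition finitely_presented (R : pzRingType) (M : lmodType R) : Prop :=
  exists (m n : nat) (f : {linear 'rV[R]_m -> 'rV[R]_n}) (g : {linear 'rV[R]_n -> M}),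
    (forall x, exists v, g v = x) /\
    (forall v, g v = 0 <-> exists u, f u = v).

Record fpmod (R : pzRingType) := FPMod {
  fp_sort :> lmodType R;
  fp_presented : finitely_presented fp_sort }.

Definition projective (R : pzRingType) (P : lmodType R) : Prop :=
  forall (V W : lmodType R) (p : {linear V -> W}) (f : {linear P -> W}),
    (forall w, exists v, p v = w) -> exists g : {linear P -> V}, forall x, p (g x) = f x.

Section FinitelyPresented.
Variable R : pzRingType.

Definition lin_of (U V : lmodType R) (f : U -> V) (fl : linear f) : {linear U -> V} :=
  let m := GRing.isLinear.Build R U V *:%R f fl in HB.pack f m.

Lemma rV_lift q (U B : lmodType R) (h : {linear 'rV[R]_q -> B}) (k : {linear U -> B}) :
  (forall w, exists u, k u = h w) ->
  exists t : {linear 'rV[R]_q -> U}, forall w, k (t w) = h w.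
Proof.
move=> kh; have [c cE] := choice (fun j => kh (delta_mx 0 j)).
pose t (w : 'rV[R]_q) := \sum_j w 0 j *: c j.
have tlin : linear t.
  move=> a x y; rewrite /t scaler_sumr -big_split /=; apply: eq_bigr => j _.
  by rewrite !mxE scalerDl scalerA.
exists (lin_of tlin) => w; rewrite {2}(row_sum_delta w) /= /t !linear_sum /=.
by apply: eq_bigr => j _; rewrite !linearZ /= cE.
Qed.

Section Copair.
Variables (A B C : lmodType R) (f : {linear A -> C}) (g : {linear B -> C}).
Definition copair (x : A * B) : C := f x.1 + g x.2.
Fact copair_linear : linear copair.
Proof. by move=> a x y; rewrite /copair /= !linearP scalerDr addrACA. Qed.
HB.instance Definition _ :=
  GRing.isLinear.Build R (A * B)%type C *:%R copair copair_linear.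
End Copair.

Section Pair.
Variables (A B C : lmodType R) (f : {linear C -> A}) (g : {linear C -> B}).
Definition pair_map (x : C) : A * B := (f x, g x).
Fact pair_map_linear : linear pair_map.
Proof. by move=> a x y; rewrite /pair_map !linearP. Qed.
HB.instance Definition _ :=
  GRing.isLinear.Build R C (A * B)%type *:%R pair_map pair_map_linear.
End Pair.

Section SumMap.
Variables (A B A' B' : lmodType R) (f : {linear A -> A'}) (g : {linear B -> B'}).
Definition sum_map (x : A * B) : A' * B' := (f x.1, g x.2).
Fact sum_map_linear : linear sum_map.
Proof. by move=> a x y; rewrite /sum_map /= !linearP. Qed.
HB.instance Definition _ :=
  GRing.isLinear.Build R (A * B)%type (A' * B')%type *:%R sum_map sum_map_linear.
End SumMap.

Lemma fp_extension (A B C : lmodType R) (i : {linear A -> B}) (p : {linear B -> C}) :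
  injective i -> (forall c, exists b, p b = c) ->
  (forall b, p b = 0 <-> exists a, i a = b) ->
  finitely_presented A -> finitely_presented C -> finitely_presented B.
Proof.
move=> i_inj p_surj ex [m [n [fA [gA [gA_surj exA]]]]] [q [r [fC [gC [gC_surj exC]]]]].
have [s sE] : exists s : {linear 'rV[R]_r -> B}, forall w, p (s w) = gC w.
  by apply: rV_lift => w; apply: p_surj.
have [t tE] : exists t : {linear 'rV[R]_q -> 'rV[R]_n},
    forall w, (i \o gA) (t w) = (s \o fC) w.
  apply: rV_lift => w /=.
  have /ex[a <-] : p (s (fC w)) = 0 by rewrite sE; apply/exC; exists w.
  by have [u <-] := gA_surj a; exists u.
have row_linear k l : exists F : {linear ('rV[R]_k * 'rV[R]_l)%type -> 'rV[R]_(k + l)},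
    exists G : {linear 'rV[R]_(k + l) -> ('rV[R]_k * 'rV[R]_l)%type},
    cancel F G /\ cancel G F.
  pose F (x : 'rV[R]_k * 'rV[R]_l) := row_mx x.1 x.2.
  pose G (x : 'rV[R]_(k + l)) := (lsubmx x, rsubmx x).
  have Fl : linear F by move=> a x y; rewrite /F scale_row_mx add_row_mx.
  have Gl : linear G by move=> a x y; rewrite /G !linearP.
  exists (lin_of Fl), (lin_of Gl); split=> x /=.
    by rewrite /F /G row_mxKl row_mxKr; case: x.
  by rewrite /F /G hsubmxK.
have [F1 [G1 [F1K G1K]]] := row_linear m q.
have [F2 [G2 [F2K G2K]]] := row_linear n r.
pose gB := copair (i \o gA) s.
pose fB (x : 'rV[R]_m * 'rV[R]_q) := (fA x.1 - t x.2, fC x.2).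
have fBl : linear fB.
  move=> a x y; rewrite /fB /= !linearP /=; congr (_, _) => /=.
  by rewrite scalerDr addrACA.
exists (m + q)%N, (n + r)%N, (F2 \o lin_of fBl \o G1), (gB \o G2); split=> [b|v].
  have [w wE] := gC_surj (p b).
  have /ex[a aE] : p (b - s w) = 0 by rewrite linearB /= sE wE subrr.
  have [u uE] := gA_surj a; exists (F2 (u, w)).
  by rewrite /= F2K /gB /copair /= uE aE subrK.
rewrite -[v]G2K; case: (G2 v) => x y; rewrite /= F2K /gB /copair /=; split=> [e0|[u]].
  have /exC[w wE] : gC y = 0.
    rewrite -sE; have /(congr1 p) := e0; rewrite linearD /= linear0.
    have -> : p (i (gA x)) = 0 by apply/ex; exists (gA x).
    by rewrite add0r.
  have /exA[u uE] : gA (x + t w) = 0.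
    apply: i_inj; rewrite linear0 !linearD /=.
    by move: (tE w) => /= ->; rewrite wE.
  by exists (F1 (u, w)); rewrite F1K /= /fB /= wE uE addrK.
move=> /(can_inj F2K)[<- <-]; rewrite !linearB /=; move: (tE (G1 u).2) => /= ->.
rewrite subrK; have -> : gA (fA (G1 u).1) = 0 by apply/exA; exists (G1 u).1.
by rewrite linear0.
Qed.

Lemma rV_presented n : finitely_presented 'rV[R]_n.
Proof.
exists 0%N, n, \0, idfun; split=> [x|v]; first by exists x.
by split=> [/= ->|[u <-]] //; exists 0.
Qed.
Definition fp_free n := FPMod (rV_presented n).

Lemma prod_presented (A B : fpmod R) : finitely_presented (A * B)%type.
Proof.
apply: (@fp_extension A _ B (pair_map idfun \0) snd).
- by move=> x y [].
- by move=> c; exists (0, c).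
- by case=> a b /=; split=> [->|[x [_ <-]]] //; exists a.
- exact: fp_presented.
- exact: fp_presented.
Qed.
Definition fp_prod (A B : fpmod R) := FPMod (prod_presented A B).

End FinitelyPresented.

(** The carrier of a [zmodType] lives in the same universe as the carriers of
  modules, so neither Yoneda Ext groups nor groups of natural transformations on
  a category of modules can be instances of [zmodType]; [abgroup] is the same
  notion one universe up.  *)

Record abgroup := AbGroup {
  ab_sort :> Type;
  ab_zero : ab_sort;
  ab_opp : ab_sort -> ab_sort;
  ab_add : ab_sort -> ab_sort -> ab_sort;
  ab_addA : associative ab_add;
  ab_addC : commutative ab_add;
  ab_add0 : left_id ab_zero ab_add;
  ab_addN : left_inverse ab_zero ab_opp ab_add }.

Record subgroup (G : abgroup) := SubGroup {
  sg_pred :> G -> Prop;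
  sg_zero : sg_pred (ab_zero G);
  sg_opp x : sg_pred x -> sg_pred (ab_opp x);
  sg_add x y : sg_pred x -> sg_pred y -> sg_pred (ab_add x y) }.

Definition group_iso (G H : abgroup) : Prop :=
  exists phi : G -> H, bijective phi /\ {morph phi : x y / ab_add x y >-> ab_add x y}.

Record eqrel (T : Type) := EqRel {
  eqr :> T -> T -> Prop;
  eqr_refl x : eqr x x;
  eqr_sym x y : eqr x y -> eqr y x;
  eqr_trans y x z : eqr x y -> eqr y z -> eqr x z }.

Section Quotient.
Variables (T : Type) (e : eqrel T).

Definition quotient := {C : T -> Prop | exists x, C = e x}.
Definition qpi (x : T) : quotient := exist _ (e x) (ex_intro _ x erefl).

Lemma qpiP x y : qpi x = qpi y <-> e x y.
Proof.
split=> [/(congr1 (@proj1_sig _ _)) /= ->|exy]; first exact: eqr_refl.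
apply: eq_exist => /=; apply/funext => z; apply/propext.
by split; apply: eqr_trans => //; apply: eqr_sym.
Qed.

Lemma qpi_surj q : exists x, qpi x = q.
Proof. by case: q => C [x eC]; exists x; apply: eq_exist. Qed.

Definition qrepr (q : quotient) : T := projT1 (cid (qpi_surj q)).
Lemma qreprK : cancel qrepr qpi.
Proof. by move=> q; rewrite /qrepr; case: cid. Qed.
End Quotient.

Section QMap.
Variables (T1 T2 T3 : Type) (e1 : eqrel T1) (e2 : eqrel T2) (e3 : eqrel T3).

Definition qmap (f : T1 -> T2) (q : quotient e1) : quotient e2 := qpi e2 (f (qrepr q)).
Lemma qmapE f : (forall x y, e1 x y -> e2 (f x) (f y)) ->
  forall x, qmap f (qpi e1 x) = qpi e2 (f x).
Proof. by move=> fP x; apply/qpiP/fP/qpiP; rewrite qreprK. Qed.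

Definition qmap2 (f : T1 -> T2 -> T3) (q : quotient e1) (r : quotient e2) :
  quotient e3 := qpi e3 (f (qrepr q) (qrepr r)).
Lemma qmap2E f : (forall x x' y y', e1 x x' -> e2 y y' -> e3 (f x y) (f x' y')) ->
  forall x y, qmap2 f (qpi e1 x) (qpi e2 y) = qpi e3 (f x y).
Proof. by move=> fP x y; apply/qpiP/fP; apply/qpiP; rewrite qreprK. Qed.
End QMap.

Section AbGroupTheory.
Variable G : abgroup.
Implicit Types x y z : G.
Local Notation "x ⊕ y" := (ab_add x y) (at level 50, left associativity).
Local Notation "⊖ x" := (ab_opp x) (at level 35, right associativity).

Lemma ab_addr0 x : x ⊕ ab_zero G = x. Proof. by rewrite ab_addC ab_add0. Qed.
Lemma ab_addrN x : x ⊕ ⊖ x = ab_zero G. Proof. by rewrite ab_addC ab_addN. Qed.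
Lemma ab_addAC x y z : x ⊕ y ⊕ z = x ⊕ z ⊕ y.
Proof. by rewrite -!ab_addA (ab_addC y). Qed.
Lemma ab_addACA x y z t : (x ⊕ y) ⊕ (z ⊕ t) = (x ⊕ z) ⊕ (y ⊕ t).
Proof. by rewrite !ab_addA (ab_addAC x). Qed.
Lemma ab_oppE x y : x ⊕ y = ab_zero G -> ⊖ x = y.
Proof. by move=> e; rewrite -[⊖ x]ab_addr0 -e ab_addA ab_addN ab_add0. Qed.
Lemma ab_oppK x : ⊖ ⊖ x = x. Proof. exact/ab_oppE/ab_addN. Qed.
Lemma ab_oppD x y : ⊖ (x ⊕ y) = ⊖ x ⊕ ⊖ y.
Proof. by apply: ab_oppE; rewrite ab_addACA !ab_addrN ab_add0. Qed.
Lemma ab_opp0 : ⊖ ab_zero G = ab_zero G. Proof. exact/ab_oppE/ab_add0. Qed.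

Variable S : subgroup G.

Definition coset_rel x y := S (x ⊕ ⊖ y).
Fact coset_rel_refl x : coset_rel x x.
Proof. by rewrite /coset_rel ab_addrN; apply: sg_zero. Qed.
Fact coset_rel_sym x y : coset_rel x y -> coset_rel y x.
Proof. by move/sg_opp; rewrite /coset_rel ab_oppD ab_oppK ab_addC. Qed.
Fact coset_rel_trans y x z : coset_rel x y -> coset_rel y z -> coset_rel x z.
Proof.
move=> /sg_add h /h; rewrite /coset_rel ab_addACA (ab_addC _ (⊖ z)) ab_addACA.
by rewrite ab_addrN ab_addr0.
Qed.
Definition coset_eqrel := EqRel coset_rel_refl coset_rel_sym coset_rel_trans.
Local Notation Q := (quotient coset_eqrel).

Definition quot_add : Q -> Q -> Q := qmap2 coset_eqrel (@ab_add G).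
Definition quot_opp : Q -> Q := qmap coset_eqrel (@ab_opp G).
Definition quot_zero : Q := qpi coset_eqrel (ab_zero G).

Lemma quot_addE x y :
  quot_add (qpi _ x) (qpi _ y) = qpi coset_eqrel (x ⊕ y).
Proof.
apply: qmap2E => a a' b b' /sg_add h /h /=.
by rewrite /coset_rel ab_addACA -ab_oppD.
Qed.
Lemma quot_oppE x : quot_opp (qpi _ x) = qpi coset_eqrel (⊖ x).
Proof. by apply: qmapE => a b /sg_opp; rewrite /= /coset_rel ab_oppD. Qed.

Fact quot_addA : associative quot_add.
Proof.
move=> q r s; case: (qpi_surj q) => x <-; case: (qpi_surj r) => y <-.
by case: (qpi_surj s) => z <-; rewrite !quot_addE ab_addA.
Qed.
Fact quot_addC : commutative quot_add.
Proof.
move=> q r; case: (qpi_surj q) => x <-; case: (qpi_surj r) => y <-.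
by rewrite !quot_addE ab_addC.
Qed.
Fact quot_add0 : left_id quot_zero quot_add.
Proof. by move=> q; case: (qpi_surj q) => x <-; rewrite quot_addE ab_add0. Qed.
Fact quot_addN : left_inverse quot_zero quot_opp quot_add.
Proof.
by move=> q; case: (qpi_surj q) => x <-; rewrite quot_oppE quot_addE ab_addN.
Qed.
Definition quot_group : abgroup := AbGroup quot_addA quot_addC quot_add0 quot_addN.
End AbGroupTheory.

Section Yoneda.
Variable R : pzRingType.
Implicit Types A B C D K M N P : fpmod R.

Record conflation (B A : fpmod R) := Conflation {
  cf_mid : fpmod R;
  cf_inj : {linear B -> cf_mid};
  cf_proj : {linear cf_mid -> A};
  cf_injP : injective cf_inj;
  cf_projP : forall a, exists e, cf_proj e = a;
  cf_exact : forall e, cf_proj e = 0 <-> exists b, cf_inj b = e }.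

Definition cf_mor B A B' A' (f : {linear B -> B'}) (g : {linear A -> A'})
    (x : conflation B A) (y : conflation B' A') : Prop :=
  exists h : {linear cf_mid x -> cf_mid y},
    (forall b, h (cf_inj x b) = cf_inj y (f b)) /\
    (forall e, cf_proj y (h e) = g (cf_proj x e)).

Lemma cf_projK B A (x : conflation B A) b : cf_proj x (cf_inj x b) = 0.
Proof. by apply/cf_exact; exists b. Qed.

(** Push-out of a conflation: the middle term is (B' x E) / {(f b, - i b)}. *)

Section PushConflation.
Variables (B A B' : fpmod R) (f : {linear B -> B'}) (x : conflation B A).

Let gl := pair_map f (\- cf_inj x).
Let gr : {linear (B' * cf_mid x)%type -> A} := copair \0 (cf_proj x).
Fact push_glue u : gr (gl u) = 0.
Proof. rewrite /gr /gl /= /copair /pair_map /=. by rewrite add0r linearN /= cf_projK oppr0. Qed.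

Definition push_mid := coker gl.
Definition push_inj : {linear B' -> push_mid} := coker_pi gl \o pair_map idfun \0.
Definition push_proj : {linear push_mid -> A} := coker_lift push_glue.

Lemma push_projE v : push_proj (coker_pi gl v) = cf_proj x v.2.
Proof. exact: etrans (coker_liftE push_glue v) (add0r _). Qed.
Fact push_injP : injective push_inj.
Proof.
move=> b c /= /coker_pi_eq[w [/= fw /eqP]].
rewrite subr0 oppr_eq0 => /eqP iw; have w0 : w = 0.
  by apply: (cf_injP (c := x)); rewrite iw linear0.
by move/eqP: fw; rewrite w0 linear0 eq_sym subr_eq0 => /eqP.
Qed.
Fact push_projP a : exists e, push_proj e = a.
Proof. by have [e <-] := cf_projP x a; exists (coker_pi gl (0, e)); rewrite push_projE. Qed.
Fact push_exact e : push_proj e = 0 <-> exists b, push_inj b = e.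
Proof.
split=> [|[b <-]]; last by rewrite push_projE /= linear0.
case: (coker_pi_surj e) => -[b' v] <-; rewrite push_projE /= => /cf_exact[b bv].
exists (b' + f b); apply/coker_pi_eq; exists b.
by rewrite /gl /= /pair_map /= -bv; congr (_, _) => /=; rewrite ?sub0r // addrAC subrr add0r.
Qed.
Fact push_presented : finitely_presented push_mid.
Proof. by apply: fp_extension push_injP push_projP push_exact _ _; apply: fp_presented. Qed.

Definition push_conflation : conflation B' A :=
  @Conflation B' A (FPMod push_presented) push_inj push_proj
    push_injP push_projP push_exact.

Lemma push_cf_mor : cf_mor f idfun x push_conflation.
Proof.
exists (coker_pi gl \o pair_map \0 idfun); split=> [b|e] /=.
  apply/coker_pi_eq; exists (- b).
  by rewrite /gl /= /pair_map /= !linearN opprK /=; congr (_, _) => /=; rewrite ?sub0r ?subr0.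
exact: push_projE.
Qed.

Lemma push_cf_univ A' (g : {linear A -> A'}) (y : conflation B' A') :
  cf_mor f g x y -> cf_mor idfun g push_conflation y.
Proof.
case=> h [h1 h2].
pose k : {linear (B' * cf_mid x)%type -> cf_mid y} := copair (cf_inj y) h.
have kg u : k (gl u) = 0.
  by rewrite /k /gl /= /copair /pair_map /= linearN /= h1 subrr.
exists (coker_lift kg); split=> [b|e].
  by apply: etrans (coker_liftE kg _) _; rewrite /k /= /copair /= linear0 addr0.
case: (coker_pi_surj e) => -[b v] <-.
apply: etrans (congr1 (cf_proj y) (coker_liftE kg _)) _.
apply: etrans _ (congr1 g (esym (push_projE _))).
by rewrite /k /= /copair /= linearD /= cf_projK add0r h2.
Qed.
End PushConflation.

(** Pull-back of a conflation: the middle term is {(e, a) | p e = g a}. *)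

Section PullConflation.
Variables (B A A' : fpmod R) (g : {linear A' -> A}) (x : conflation B A).

Let d : {linear (cf_mid x * A')%type -> A} := copair (cf_proj x) (\- g).
Fact pull_memP v : reflect (cf_proj x v.1 = g v.2) (v \in ker_pred d).
Proof. by rewrite unfold_in /d /= /copair /pair_map /= subr_eq0; apply: eqP. Qed.

Definition pull_mid := lker d.
Fact pull_inj_mem b : (cf_inj x b, 0) \in ker_pred d.
Proof. by apply/pull_memP; rewrite /= cf_projK linear0. Qed.
Definition pull_inj_fun (b : B) : pull_mid := Sub (cf_inj x b, 0) (pull_inj_mem b).
Fact pull_inj_linear : linear pull_inj_fun.
Proof.
move=> a u v; apply: val_inj; rewrite linearP /= linearP.
by congr (_, _) => /=; rewrite scaler0 addr0.
Qed.
Definition pull_inj : {linear B -> pull_mid} := lin_of pull_inj_linear.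
Definition pull_proj : {linear pull_mid -> A'} := snd \o val.

Fact pull_injP : injective pull_inj.
Proof. by move=> b c /(congr1 val) /= []; apply: cf_injP. Qed.
Fact pull_projP a : exists e, pull_proj e = a.
Proof.
have [e ea] := cf_projP x (g a).
have m : (e, a) \in ker_pred d by apply/pull_memP.
by exists (Sub (e, a) m : pull_mid).
Qed.
Fact pull_exact e : pull_proj e = 0 <-> exists b, pull_inj b = e.
Proof.
split=> [|[b <-] //]; case: e => -[e a] m /= a0.
have /cf_exact[b be] : cf_proj x e = 0.
  by have /= -> := pull_memP _ m; rewrite [X in g X]a0 linear0.
by exists b; apply: val_inj; rewrite /= be a0.
Qed.
Fact pull_presented : finitely_presented pull_mid.
Proof. by apply: fp_extension pull_injP pull_projP pull_exact _ _; apply: fp_presented. Qed.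

Definition pull_conflation : conflation B A' :=
  @Conflation B A' (FPMod pull_presented) pull_inj pull_proj
    pull_injP pull_projP pull_exact.

Lemma pull_cf_mor : cf_mor idfun g pull_conflation x.
Proof.
exists (fst \o val); split=> [b|[v m]] //=; exact/pull_memP.
Qed.

Lemma pull_cf_univ B' (f : {linear B' -> B}) (y : conflation B' A') :
  cf_mor f g y x -> cf_mor f idfun y pull_conflation.
Proof.
case=> h [h1 h2].
have m e : (h e, cf_proj y e) \in ker_pred d by apply/pull_memP; rewrite /= h2.
pose k e : pull_mid := Sub (h e, cf_proj y e) (m e).
have kl : linear k.
  by move=> a u v; apply: val_inj; rewrite linearP /= !linearP.
exists (lin_of kl); split=> [b|e] //=.
by apply: val_inj; rewrite /= h1 cf_projK.
Qed.
End PullConflation.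

Section SumConflation.
Variables (B A B' A' : fpmod R) (x : conflation B A) (x' : conflation B' A').
Let i := sum_map (cf_inj x) (cf_inj x').
Let p := sum_map (cf_proj x) (cf_proj x').
Fact sum_injP : injective i.
Proof. by move=> [a b] [c d] [/cf_injP-> /cf_injP->]. Qed.
Fact sum_projP a : exists e, p e = a.
Proof.
case: a => a a'; have [e ea] := cf_projP x a; have [e' ea'] := cf_projP x' a'.
by exists (e, e'); rewrite /p /= /sum_map /= ea ea'.
Qed.
Fact sum_exact e : p e = 0 <-> exists b, i b = e.
Proof.
split=> [|[b <-]]; last by rewrite /p /i /= /sum_map /= !cf_projK.
by case: e => e e' [/cf_exact[b <-] /cf_exact[b' <-]]; exists (b, b').
Qed.
Definition sum_conflation : conflation (fp_prod B B') (fp_prod A A') :=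
  @Conflation (fp_prod B B') (fp_prod A A') (fp_prod (cf_mid x) (cf_mid x')) i p
    sum_injP sum_projP sum_exact.
End SumConflation.

Section SplitConflation.
Variables (B A : fpmod R).
Let i : {linear B -> (B * A)%type} := pair_map idfun \0.
Fact split_injP : injective i.
Proof. by move=> b c []. Qed.
Fact split_projP a : exists e : B * A, e.2 = a.
Proof. by exists (0, a). Qed.
Fact split_exact (e : B * A) : e.2 = 0 <-> exists b, i b = e.
Proof. by case: e => b a; split=> [/= ->|[c [_ <-]]] //; exists b. Qed.
Definition split_conflation : conflation B A :=
  @Conflation B A (fp_prod B A) i snd split_injP split_projP split_exact.
End SplitConflation.

(** [yextS n A B]: exact sequences 0 -> B -> E_n -> ... -> E_0 -> A -> 0 in R-mod,
    presented as splices of n.+1 conflations; [cf_mid] of the outermost conflation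
    is E_n.  [yext n] consists of n-fold extensions, and of morphisms A -> B if
    n = 0. *)

Fixpoint yextS (n : nat) (A B : fpmod R) : Type :=
  match n with
  | 0 => conflation B A
  | n'.+1 => {K : fpmod R & (conflation B K * yextS n' A K)%type}
  end.

Definition yext (n : nat) (A B : fpmod R) : Type :=
  match n with
  | 0 => {linear A -> B}
  | n'.+1 => yextS n' A B
  end.

(** Morphisms of extensions with given maps f and g on the left and right ends. *)

Fixpoint ymorS n A B A' B' (f : {linear B -> B'}) (g : {linear A -> A'}) :
    yextS n A B -> yextS n A' B' -> Prop :=
  match n with
  | 0 => cf_mor f g
  | n'.+1 => fun x y =>
      exists k : {linear projT1 x -> projT1 y},
        cf_mor f k (projT2 x).1 (projT2 y).1 /\
        ymorS k g (projT2 x).2 (projT2 y).2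
  end.

Definition ymor n A B A' B' (f : {linear B -> B'}) (g : {linear A -> A'}) :
    yext n A B -> yext n A' B' -> Prop :=
  match n with
  | 0 => fun x y => forall a, f (x a) = y (g a)
  | n'.+1 => @ymorS n' A B A' B' f g
  end.

(** Yoneda equivalence: generated by the morphisms that are the identity on both
    ends; for n = 0 it is pointwise equality. *)

Inductive yeqv n A B : yext n A B -> yext n A B -> Prop :=
| yeqv_mor x y : ymor idfun idfun x y -> yeqv x y
| yeqv_refl x : yeqv x x
| yeqv_sym x y : yeqv x y -> yeqv y x
| yeqv_trans y x z : yeqv x y -> yeqv y z -> yeqv x z.

Definition yeqrel n A B : eqrel (yext n A B) :=
  EqRel (@yeqv_refl n A B) (@yeqv_sym n A B) (@yeqv_trans n A B).

Definition ypush n A B B' (f : {linear B -> B'}) : yext n A B -> yext n A B' :=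
  match n with
  | 0 => fun x => f \o x
  | n'.+1 => match n' with
    | 0 => fun x => push_conflation f x
    | n''.+1 => fun x => existT _ (projT1 x)
                           (push_conflation f (projT2 x).1, (projT2 x).2)
    end
  end.

Fixpoint ypullS n A A' B (g : {linear A' -> A}) : yextS n A B -> yextS n A' B :=
  match n with
  | 0 => fun x => pull_conflation g x
  | n'.+1 => fun x => existT _ (projT1 x) ((projT2 x).1, ypullS g (projT2 x).2)
  end.

Definition ypull n A A' B (g : {linear A' -> A}) : yext n A B -> yext n A' B :=
  match n with
  | 0 => fun x => x \o g
  | n'.+1 => @ypullS n' A A' B g
  end.

Fixpoint ysumS n A B A' B' :
    yextS n A B -> yextS n A' B' -> yextS n (fp_prod A A') (fp_prod B B') :=
  match n with
  | 0 => fun x y => sum_conflation x y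
  | n'.+1 => fun x y => existT _ (fp_prod (projT1 x) (projT1 y))
      (sum_conflation (projT2 x).1 (projT2 y).1, ysumS (projT2 x).2 (projT2 y).2)
  end.

Definition ysum n A B A' B' :
    yext n A B -> yext n A' B' -> yext n (fp_prod A A') (fp_prod B B') :=
  match n with
  | 0 => fun x y => sum_map x y
  | n'.+1 => @ysumS n' A B A' B'
  end.

Fixpoint yzeroS n A B : yextS n A B :=
  match n with
  | 0 => split_conflation B A
  | n'.+1 => existT _ (fp_free R 0) (split_conflation B (fp_free R 0), yzeroS n' A (fp_free R 0))
  end.

Definition yzero n A B : yext n A B :=
  match n with
  | 0 => \0
  | n'.+1 => yzeroS n' A B
  end.

Definition diagm A : {linear A -> fp_prod A A} := pair_map idfun idfun.
Definition codiagm B : {linear fp_prod B B -> B} := copair idfun idfun.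

(** Baer sum; for n = 0 this is the pointwise sum of morphisms. *)

Definition yadd n A B (x y : yext n A B) : yext n A B :=
  ypush (codiagm B) (ypull (diagm A) (ysum x y)).

Definition yopp n A B (x : yext n A B) : yext n A B := ypush (\- idfun) x.

Definition fp_fst A B : {linear fp_prod A B -> A} := fst.
Definition fp_snd A B : {linear fp_prod A B -> B} := snd.

Definition fp_sum_map A B A' B' (f : {linear A -> A'}) (g : {linear B -> B'}) :
  {linear fp_prod A B -> fp_prod A' B'} := sum_map f g.

Lemma cf_mor_id B A (x : conflation B A) : cf_mor idfun idfun x x.
Proof. by exists idfun. Qed.

Lemma cf_mor_comp B A B' A' B'' A'' (f : {linear B -> B'}) (g : {linear A -> A'})
    (f' : {linear B' -> B''}) (g' : {linear A' -> A''})
    (x : conflation B A) (y : conflation B' A') (z : conflation B'' A'') :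
  cf_mor f g x y -> cf_mor f' g' y z -> cf_mor (f' \o f) (g' \o g) x z.
Proof.
move=> [h [h1 h2]] [k [k1 k2]]; exists (k \o h); split=> [b|e] /=.
  by rewrite h1 k1.
by rewrite k2 h2.
Qed.

Lemma cf_mor_ext B A B' A' (f f' : {linear B -> B'}) (g g' : {linear A -> A'})
    (x : conflation B A) (y : conflation B' A') :
  f =1 f' -> g =1 g' -> cf_mor f g x y -> cf_mor f' g' x y.
Proof.
move=> ff gg [h [h1 h2]]; exists h; split=> [b|e]; first by rewrite h1 ff.
by rewrite h2 gg.
Qed.

Lemma cf_mor_sum B A B' A' C D C' D' (f : {linear B -> B'}) (g : {linear A -> A'})
    (f' : {linear C -> C'}) (g' : {linear D -> D'})
    (x : conflation B A) (y : conflation B' A')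
    (x' : conflation C D) (y' : conflation C' D') :
  cf_mor f g x y -> cf_mor f' g' x' y' ->
  cf_mor (fp_sum_map f f') (fp_sum_map g g') (sum_conflation x x') (sum_conflation y y').
Proof.
move=> [h [h1 h2]] [k [k1 k2]]; exists (fp_sum_map h k : {linear cf_mid (sum_conflation x x') -> cf_mid (sum_conflation y y')}).
by split=> -[b c] /=; rewrite /= /sum_map /= ?h1 ?h2 ?k1 ?k2.
Qed.

Lemma cf_mor_split B A B' A' (x : conflation B A) (g : {linear A -> A'}) :
  cf_mor \0 g x (split_conflation B' A').
Proof.
exists (pair_map \0 (g \o cf_proj x)); split=> [b|e] //=.
by rewrite /pair_map /= cf_projK linear0.
Qed.

Lemma ymor_id n A B (x : yext n A B) : ymor idfun idfun x x.
Proof.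
case: n x => [|n] //= x.
elim: n B x => [|n IH] B /= x; first exact: cf_mor_id.
by exists idfun; split; [apply: cf_mor_id | apply: IH].
Qed.

Lemma ymor_comp n A B A' B' A'' B'' (f : {linear B -> B'}) (g : {linear A -> A'})
    (f' : {linear B' -> B''}) (g' : {linear A' -> A''})
    (x : yext n A B) (y : yext n A' B') (z : yext n A'' B'') :
  ymor f g x y -> ymor f' g' y z -> ymor (f' \o f) (g' \o g) x z.
Proof.
case: n x y z => [|n] /= x y z; first by move=> h k a /=; rewrite h k.
elim: n B B' B'' f f' x y z => [|n IH] B B' B'' f f' x y z /=.
  exact: cf_mor_comp.
move=> [k [h1 h2]] [k' [h1' h2']]; exists (k' \o k); split.
  exact: cf_mor_comp h1 h1'.
exact: IH h2 h2'.
Qed.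

Lemma ymor_ext n A B A' B' (f f' : {linear B -> B'}) (g g' : {linear A -> A'})
    (x : yext n A B) (y : yext n A' B') :
  f =1 f' -> g =1 g' -> ymor f g x y -> ymor f' g' x y.
Proof.
move=> ff gg; case: n x y => [|n] /= x y.
  by move=> h a; rewrite -ff -gg h.
elim: n B B' f f' ff x y => [|n IH] B B' f f' ff x y /=; first exact: cf_mor_ext.
move=> [k [h1 h2]]; exists k; split; last exact: IH h2.
exact: cf_mor_ext h1.
Qed.

Lemma ymor_sum n A B A' B' C D C' D' (f : {linear B -> B'}) (g : {linear A -> A'})
    (f' : {linear D -> D'}) (g' : {linear C -> C'})
    (x : yext n A B) (y : yext n A' B') (x' : yext n C D) (y' : yext n C' D') :
  ymor f g x y -> ymor f' g' x' y' ->
  ymor (fp_sum_map f f') (fp_sum_map g g') (ysum x x') (ysum y y').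
Proof.
case: n x y x' y' => [|n] /= x y x' y'.
  by move=> h k [a c]; rewrite /= /sum_map /= h k.
elim: n B B' D D' f f' x y x' y' => [|n IH] B B' D D' f f' x y x' y' /=.
  exact: cf_mor_sum.
move=> [k [h1 h2]] [k' [h1' h2']]; exists (fp_sum_map k k'); split.
  exact: cf_mor_sum.
exact: IH.
Qed.

Lemma ymor_diag n A B (x : yext n A B) : ymor (diagm B) (diagm A) x (ysum x x).
Proof.
case: n x => [|n] //= x.
elim: n B x => [|n IH] B /= x; first by exists (pair_map idfun idfun).
exists (diagm (projT1 x)); split; last exact: IH.
by exists (pair_map idfun idfun).
Qed.

Lemma ymor_zero n A B B' (x : yext n A B) : ymor \0 idfun x (yzero n A B').
Proof.
case: n x => [|n] //= x.
elim: n B B' x => [|n IH] B B' /= x; first exact: cf_mor_split.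
by exists \0; split; [apply: cf_mor_split | apply: IH].
Qed.

Lemma ypush_mor n A B B' (f : {linear B -> B'}) (x : yext n A B) :
  ymor f idfun x (ypush f x).
Proof.
case: n x => [|[|n]] //= x; first exact: push_cf_mor.
by exists idfun; split; [apply: push_cf_mor | apply: (@ymor_id n.+1)].
Qed.

Lemma ypush_univ n A B B' A' (f : {linear B -> B'}) (g : {linear A -> A'})
    (x : yext n A B) (y : yext n A' B') :
  ymor f g x y -> ymor idfun g (ypush f x) y.
Proof.
case: n x y => [|[|n]] //= x y; first exact: push_cf_univ.
by move=> [k [h1 h2]]; exists k; split=> //; apply: push_cf_univ.
Qed.

Lemma ypull_mor n A A' B (g : {linear A' -> A}) (x : yext n A B) :
  ymor idfun g (ypull g x) x.
Proof.
case: n x => [|n] //= x.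
elim: n B x => [|n IH] B /= x; first exact: pull_cf_mor.
by exists idfun; split; [apply: cf_mor_id | apply: IH].
Qed.

Lemma ypull_univ n A A' B B' (f : {linear B' -> B}) (g : {linear A' -> A})
    (x : yext n A B) (y : yext n A' B') :
  ymor f g y x -> ymor f idfun y (ypull g x).
Proof.
case: n x y => [|n] //= x y.
elim: n B B' f x y => [|n IH] B B' f x y /=; first exact: pull_cf_univ.
by move=> [k [h1 h2]]; exists k; split=> //; apply: IH.
Qed.

(** Mac Lane, Homology, III.5: a morphism of extensions with ends f and g
    identifies f_* x with g^* y. *)

Lemma yeqv_push_pull n A B A' B' (f : {linear B -> B'}) (g : {linear A -> A'})
    (x : yext n A B) (y : yext n A' B') :
  ymor f g x y -> yeqv (ypush f x) (ypull g y).
Proof. by move=> h; apply/yeqv_mor/ypull_univ/ypush_univ. Qed.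

Lemma yeqv_push n A B B' (f : {linear B -> B'}) (x : yext n A B) (y : yext n A B') :
  ymor f idfun x y -> yeqv (ypush f x) y.
Proof. by move=> h; apply/yeqv_mor/ypush_univ. Qed.

Lemma yeqv_pull n A A' B (g : {linear A' -> A}) (x : yext n A B) (y : yext n A' B) :
  ymor idfun g y x -> yeqv y (ypull g x).
Proof. by move=> h; apply/yeqv_mor/ypull_univ. Qed.

Lemma ypush_eqv n A B B' (f : {linear B -> B'}) (x y : yext n A B) :
  yeqv x y -> yeqv (ypush f x) (ypush f y).
Proof.
elim=> {x y} [x y h|x|x y _|y x z _ h _ k].
- by apply: yeqv_push; apply: ymor_ext (ymor_comp h (ypush_mor f y)).
- exact: yeqv_refl.
- exact: yeqv_sym.
- exact: yeqv_trans h k.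
Qed.

Lemma ypull_eqv n A A' B (g : {linear A' -> A}) (x y : yext n A B) :
  yeqv x y -> yeqv (ypull g x) (ypull g y).
Proof.
elim=> {x y} [x y h|x|x y _|y x z _ h _ k].
- by apply: yeqv_pull; apply: ymor_ext (ymor_comp (ypull_mor g x) h).
- exact: yeqv_refl.
- exact: yeqv_sym.
- exact: yeqv_trans h k.
Qed.

Lemma ysum_eqv n A B A' B' (x y : yext n A B) (x' y' : yext n A' B') :
  yeqv x y -> yeqv x' y' -> yeqv (ysum x x') (ysum y y').
Proof.
move=> h h'; apply: (@yeqv_trans _ _ _ (ysum y x')).
  elim: h => {x y} [x y h|x|x y _|y x z _ h _ k].
  - apply: yeqv_mor; apply: ymor_ext (ymor_sum h (ymor_id x')); by case.
  - exact: yeqv_refl.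
  - exact: yeqv_sym.
  - exact: yeqv_trans h k.
elim: h' => {x' y'} [x' y' h'|x'|x' y' _|y' x' z' _ h' _ k'].
- apply: yeqv_mor; apply: ymor_ext (ymor_sum (ymor_id y) h'); by case.
- exact: yeqv_refl.
- exact: yeqv_sym.
- exact: yeqv_trans h' k'.
Qed.

Lemma yadd_eqv n A B (x y x' y' : yext n A B) :
  yeqv x y -> yeqv x' y' -> yeqv (yadd x x') (yadd y y').
Proof. by move=> h h'; apply/ypush_eqv/ypull_eqv/ysum_eqv. Qed.

Lemma ypush_comp n A B B' B'' (f : {linear B -> B'}) (f' : {linear B' -> B''})
    (x : yext n A B) :
  yeqv (ypush f' (ypush f x)) (ypush (f' \o f) x).
Proof.
apply/yeqv_sym/yeqv_push.
by apply: ymor_ext (ymor_comp (ypush_mor f x) (ypush_mor f' _)).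
Qed.

Lemma ypull_comp n A A' A'' B (g : {linear A' -> A}) (g' : {linear A'' -> A'})
    (x : yext n A B) :
  yeqv (ypull g' (ypull g x)) (ypull (g \o g') x).
Proof.
by apply/yeqv_pull; apply: ymor_ext (ymor_comp (ypull_mor g' _) (ypull_mor g x)).
Qed.

Lemma ypush_ypull n A A' B B' (f : {linear B -> B'}) (g : {linear A' -> A})
    (x : yext n A B) :
  yeqv (ypush f (ypull g x)) (ypull g (ypush f x)).
Proof.
apply: yeqv_push_pull.
by apply: ymor_ext (ymor_comp (ypull_mor g x) (ypush_mor f x)).
Qed.

Lemma ypush_ext n A B B' (f f' : {linear B -> B'}) (x : yext n A B) :
  f =1 f' -> yeqv (ypush f x) (ypush f' x).
Proof. by move=> ff; apply/yeqv_push; apply: ymor_ext (ypush_mor f' x). Qed.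

Lemma ypull_ext n A A' B (g g' : {linear A' -> A}) (x : yext n A B) :
  g =1 g' -> yeqv (ypull g x) (ypull g' x).
Proof. by move=> gg; apply/yeqv_pull; apply: ymor_ext (ypull_mor g x). Qed.

Lemma ypush_id n A B (x : yext n A B) : yeqv (ypush idfun x) x.
Proof. by apply/yeqv_push/ymor_id. Qed.

Lemma ypush_addl n A B B' (f g : {linear B -> B'}) (x : yext n A B) :
  yeqv (yadd (ypush f x) (ypush g x)) (ypush (f \+ g) x).
Proof.
have m : ymor (pair_map f g : {linear B -> fp_prod B' B'}) (diagm A) x (ysum (ypush f x) (ypush g x)).
  by apply: ymor_ext (ymor_comp (ymor_diag x) (ymor_sum (ypush_mor f x) (ypush_mor g x))).
apply/yeqv_sym; apply: yeqv_trans (ypush_eqv _ (yeqv_push_pull m)).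
apply: yeqv_trans (yeqv_sym (ypush_comp _ _ _)).
exact: ypush_ext.
Qed.

Lemma ypush_addr n A B B' (f : {linear B -> B'}) (x y : yext n A B) :
  yeqv (ypush f (yadd x y)) (yadd (ypush f x) (ypush f y)).
Proof.
have m := ymor_sum (ypush_mor f x) (ypush_mor f y).
have {}m : ymor (fp_sum_map f f) (diagm A) (ypull (diagm A) (ysum x y))
    (ysum (ypush f x) (ypush f y)).
  apply: ymor_ext (ymor_comp (ypull_mor (diagm A) (ysum x y)) m) => //.
apply: yeqv_trans (ypush_eqv _ (yeqv_push_pull m)).
apply: yeqv_trans (ypush_comp _ _ _) _.
apply: yeqv_trans (yeqv_sym (ypush_comp _ _ _)).
by apply: ypush_ext => -[b c] /=; rewrite /codiagm /= /copair /sum_map /= linearD.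
Qed.

(** Two (hence finitely many) elements of Ext^n(A, B) are push-outs of a common
    element; this reduces the group axioms to [ypush_addl]. *)

Lemma ymor_fst n A B A' B' (x : yext n A B) (y : yext n A' B') :
  ymor (fp_fst B B') (fp_fst A A')
    (ysum x y) x.
Proof.
case: n x y => [|n] //= x y.
elim: n B B' x y => [|n IH] B B' /= x y.
  by exists (fp_fst _ _).
by exists (fp_fst _ _); split; [exists (fp_fst _ _) | apply: IH].
Qed.

Lemma ymor_snd n A B A' B' (x : yext n A B) (y : yext n A' B') :
  ymor (fp_snd B B') (fp_snd A A')
    (ysum x y) y.
Proof.
case: n x y => [|n] //= x y.
elim: n B B' x y => [|n IH] B B' /= x y.
  by exists (fp_snd _ _).
by exists (fp_snd _ _); split; [exists (fp_snd _ _) | apply: IH].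
Qed.

Lemma yext_common n A B B' (x : yext n A B) (y : yext n A B') :
  exists w : yext n A (fp_prod B B'),
    yeqv (ypush (fp_fst B B') w) x /\
    yeqv (ypush (fp_snd B B') w) y.
Proof.
exists (ypull (diagm A) (ysum x y)); split; apply: yeqv_push.
  by apply: ymor_ext (ymor_comp (ypull_mor _ _) (ymor_fst x y)).
by apply: ymor_ext (ymor_comp (ypull_mor _ _) (ymor_snd x y)).
Qed.

Lemma yaddC n A B (x y : yext n A B) : yeqv (yadd x y) (yadd y x).
Proof.
have [w [wx wy]] := yext_common x y.
apply: yeqv_trans (yadd_eqv (yeqv_sym wx) (yeqv_sym wy)) _.
apply: yeqv_trans (yadd_eqv wy wx).
apply: yeqv_trans (ypush_addl _ _ _) _.
apply: yeqv_trans (yeqv_sym (ypush_addl _ _ _)).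
by apply: ypush_ext => v /=; rewrite addrC.
Qed.

Lemma yaddA n A B (x y z : yext n A B) :
  yeqv (yadd x (yadd y z)) (yadd (yadd x y) z).
Proof.
have [v [vx vy]] := yext_common x y; have [w [wv wz]] := yext_common v z.
have wx : yeqv (ypush (fp_fst B B \o fp_fst (fp_prod B B) B) w) x.
  apply: yeqv_trans (yeqv_sym (ypush_comp _ _ _)) _.
  exact: yeqv_trans (ypush_eqv _ wv) vx.
have wy : yeqv (ypush (fp_snd B B \o fp_fst (fp_prod B B) B) w) y.
  apply: yeqv_trans (yeqv_sym (ypush_comp _ _ _)) _.
  exact: yeqv_trans (ypush_eqv _ wv) vy.
have [wx' wy' wz'] := And3 (yeqv_sym wx) (yeqv_sym wy) (yeqv_sym wz).
apply: yeqv_trans (yadd_eqv wx' (yadd_eqv wy' wz')) _.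
apply: yeqv_trans (yadd_eqv (yeqv_refl _) (ypush_addl _ _ _)) _.
apply: yeqv_trans (ypush_addl _ _ _) _.
apply: yeqv_trans (yadd_eqv (yadd_eqv wx wy) wz).
apply: yeqv_trans (yadd_eqv (yeqv_sym (ypush_addl _ _ _)) (yeqv_refl _)).
apply: yeqv_trans (yeqv_sym (ypush_addl _ _ _)).
by apply: ypush_ext => u /=; rewrite addrA.
Qed.

Lemma yzeroE n A B B' (x : yext n A B) : yeqv (ypush \0 x) (yzero n A B').
Proof. exact/yeqv_push/ymor_zero. Qed.

Lemma yadd0 n A B (x : yext n A B) : yeqv (yadd (yzero n A B) x) x.
Proof.
apply: yeqv_trans (yadd_eqv (yeqv_sym (yzeroE B x)) (yeqv_sym (ypush_id x))) _.
apply: yeqv_trans (ypush_addl _ _ _) _.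
apply: yeqv_trans (ypush_id x).
by apply: ypush_ext => u /=; rewrite add0r.
Qed.

Lemma yaddN n A B (x : yext n A B) : yeqv (yadd (yopp x) x) (yzero n A B).
Proof.
apply: yeqv_trans (yadd_eqv (yeqv_refl _) (yeqv_sym (ypush_id x))) _.
apply: yeqv_trans (ypush_addl _ _ _) _.
apply: yeqv_trans (yzeroE B x).
by apply: ypush_ext => u /=; rewrite addNr.
Qed.

Section ExtGroup.
Variables (n : nat) (A B : fpmod R).
Local Notation E := (quotient (@yeqrel n A B)).

Definition ext_add : E -> E -> E := qmap2 (@yeqrel n A B) (@yadd n A B).
Definition ext_opp : E -> E := qmap (@yeqrel n A B) (@yopp n A B).
Definition ext_zero : E := qpi (@yeqrel n A B) (yzero n A B).

Lemma ext_addE x y : ext_add (qpi _ x) (qpi _ y) = qpi (@yeqrel n A B) (yadd x y).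
Proof. by apply: qmap2E => *; apply: yadd_eqv. Qed.
Lemma ext_oppE x : ext_opp (qpi _ x) = qpi (@yeqrel n A B) (yopp x).
Proof. by apply: qmapE => *; apply: ypush_eqv. Qed.

Fact ext_addA : associative ext_add.
Proof.
move=> q r s; case: (qpi_surj q) => x <-; case: (qpi_surj r) => y <-.
by case: (qpi_surj s) => z <-; rewrite !ext_addE; apply/qpiP/yaddA.
Qed.
Fact ext_addC : commutative ext_add.
Proof.
move=> q r; case: (qpi_surj q) => x <-; case: (qpi_surj r) => y <-.
by rewrite !ext_addE; apply/qpiP/yaddC.
Qed.
Fact ext_add0 : left_id ext_zero ext_add.
Proof.
by move=> q; case: (qpi_surj q) => x <-; rewrite ext_addE; apply/qpiP/yadd0.
Qed.
Fact ext_addN : left_inverse ext_zero ext_opp ext_add.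
Proof.
by move=> q; case: (qpi_surj q) => x <-; rewrite ext_oppE ext_addE; apply/qpiP/yaddN.
Qed.
Definition Ext : abgroup := AbGroup ext_addA ext_addC ext_add0 ext_addN.
End ExtGroup.

Definition ext_push n A B B' (f : {linear B -> B'}) : Ext n A B -> Ext n A B' :=
  qmap (@yeqrel n A B') (ypush f).

Lemma ext_pushE n A B B' (f : {linear B -> B'}) (x : yext n A B) :
  ext_push f (qpi (@yeqrel n A B) x) = qpi (@yeqrel n A B') (ypush f x).
Proof. by apply: qmapE => y z; apply: ypush_eqv. Qed.

(** P is projective in the exact category R-mod: it lifts along deflations. *)

Definition fp_projective P : Prop :=
  forall B A (x : conflation B A) (f : {linear P -> A}),
    exists g : {linear P -> cf_mid x}, forall p, cf_proj x (g p) = f p.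

(** A conflation has all its terms finitely presented, so [projective (cf_mid x)]
    says that the middle term is a finitely generated projective module. *)

Definition enough_projectives : Prop :=
  forall A, exists K, exists x : conflation K A, projective (cf_mid x).

Inductive is_syzygy N : nat -> fpmod R -> Prop :=
| syzygy0 : is_syzygy N 0 N
| syzygyS n K L (x : conflation L K) :
    is_syzygy N n K -> fp_projective (cf_mid x) -> is_syzygy N n.+1 L.

Section ProjFactor.
Variables (n : nat) (M L : fpmod R).

Definition proj_factor (alpha : Ext n M L) : Prop :=
  exists P (f : {linear P -> L}) (beta : Ext n M P),
    fp_projective P /\ alpha = ext_push f beta.

Fact fp_projective_prod P Q :
  fp_projective P -> fp_projective Q -> fp_projective (fp_prod P Q).
Proof.
move=> pP pQ B A x f.
have [g gE] := pP B A x (f \o pair_map idfun \0).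
have [h hE] := pQ B A x (f \o pair_map \0 idfun).
exists (copair g h) => -[p q]; rewrite /= /copair linearD gE hE /= -linearD /=.
by congr (f _); congr (_, _) => /=; rewrite ?addr0 ?add0r.
Qed.

Fact fp_projective_free k : fp_projective (fp_free R k).
Proof. by move=> B A x f; apply: rV_lift => w; apply: cf_projP. Qed.

Fact proj_factor_zero : proj_factor (ab_zero (Ext n M L)).
Proof.
exists (fp_free R 0), \0, (ab_zero _); split; first exact: fp_projective_free.
by rewrite /= ext_pushE; apply/esym/qpiP/yzeroE.
Qed.
Fact proj_factor_opp alpha : proj_factor alpha -> proj_factor (ab_opp alpha).
Proof.
move=> [P [f [beta [pP ->]]]]; exists P, (\- f), beta; split=> //.
case: (qpi_surj beta) => x <-; rewrite /= !ext_pushE ext_oppE; apply/qpiP.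
by apply: yeqv_trans (ypush_comp _ _ _) _; apply: ypush_ext.
Qed.
Fact proj_factor_add alpha beta :
  proj_factor alpha -> proj_factor beta -> proj_factor (ab_add alpha beta).
Proof.
move=> [P [f [a [pP ->]]]] [Q [g [b [pQ ->]]]].
case: (qpi_surj a) => x <-; case: (qpi_surj b) => y <-.
have [w [wx wy]] := yext_common x y.
exists (fp_prod P Q), (copair f g), (qpi _ w); split.
  exact: fp_projective_prod.
rewrite /= !ext_pushE ext_addE; apply/qpiP.
apply: yeqv_trans (yadd_eqv (ypush_eqv f (yeqv_sym wx)) (ypush_eqv g (yeqv_sym wy))) _.
apply: yeqv_trans (yadd_eqv (ypush_comp _ _ _) (ypush_comp _ _ _)) _.
by apply: yeqv_trans (ypush_addl _ _ _) _; apply: ypush_ext.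
Qed.

Definition proj_factor_group : subgroup (Ext n M L) :=
  SubGroup proj_factor_zero proj_factor_opp proj_factor_add.
End ProjFactor.

End Yoneda.

(** X (x)_R V is the set of formal sums of pairs (x, v) modulo the congruence
  generated by the bilinear relations; formal differences are not needed because
  (- x, v) is opposite to (x, v).  *)

Section Tensor.
Variables (R : pzRingType) (X : lmodType R^c) (V : lmodType R).

Inductive tens_rel : seq (X * V) -> seq (X * V) -> Prop :=
| tens_refl s : tens_rel s s
| tens_sym s t : tens_rel s t -> tens_rel t s
| tens_trans t s u : tens_rel s t -> tens_rel t u -> tens_rel s u
| tens_cat s s' t t' : tens_rel s s' -> tens_rel t t' -> tens_rel (s ++ t) (s' ++ t')
| tens_comm s t : tens_rel (s ++ t) (t ++ s)
| tens_0 : tens_rel [:: (0, 0)] [::]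
| tens_addl x x' v : tens_rel [:: (x + x', v)] [:: (x, v); (x', v)]
| tens_addr x v v' : tens_rel [:: (x, v + v')] [:: (x, v); (x, v')]
| tens_balanced x (r : R) v : tens_rel [:: ((r : R^c) *: x, v)] [:: (x, r *: v)].

Definition tens_relb (s t : seq (X * V)) := `[< tens_rel s t >].
Fact tens_relb_equiv : equiv_class_of tens_relb.
Proof.
split=> [s|s t|t s u]; first exact/asboolP/tens_refl.
  by apply/asboolP/asboolP; apply: tens_sym.
by move=> /asboolP st /asboolP tu; apply/asboolP/(tens_trans st).
Qed.
Canonical tens_equiv := EquivRelPack tens_relb_equiv.
Canonical tens_encModRel := defaultEncModRel tens_relb.

Definition tensor := {eq_quot tens_relb}.
HB.instance Definition _ : EqQuotient _ tens_relb tensor := EqQuotient.on tensor.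
HB.instance Definition _ := Choice.on tensor.

Definition tens_pi (s : seq (X * V)) : tensor := \pi_tensor s.

Lemma tens_piP s t : tens_pi s = tens_pi t <-> tens_rel s t.
Proof. by split=> [/eqmodP/asboolP|st] //; apply/eqmodP/asboolP. Qed.
Lemma tens_pi_surj q : exists s, tens_pi s = q.
Proof. by exists (repr q); rewrite /tens_pi reprK. Qed.

Definition tens_neg (s : seq (X * V)) := [seq (- p.1, p.2) | p <- s].

Lemma tens_pair0 v : tens_rel [:: (0, v)] [::].
Proof.
have := tens_balanced 0 0 v; rewrite scaler0 scale0r => h.
exact: tens_trans h tens_0.
Qed.

Lemma tens_negK s : tens_rel (tens_neg s ++ s) [::].
Proof.
elim: s => [|[x v] s IH] /=; first exact: tens_refl.
apply: (@tens_trans ([:: (- x, v); (x, v)] ++ (tens_neg s ++ s))).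
  suff h : tens_rel (tens_neg s ++ (x, v) :: s) ((x, v) :: tens_neg s ++ s).
    exact: tens_cat (tens_refl [:: (- x, v)]) h.
  rewrite -cat1s -[(x, v) :: tens_neg s ++ s]cat1s !catA; apply: tens_cat (tens_refl s).
  exact: tens_comm.
rewrite -[[::]]cats0; apply: tens_cat IH.
apply: tens_trans (tens_sym (tens_addl _ _ _)) _.
by rewrite addNr; apply: tens_pair0.
Qed.

Lemma tens_neg_rel s t : tens_rel s t -> tens_rel (tens_neg s) (tens_neg t).
Proof.
move=> st; rewrite -[tens_neg s]cats0.
apply: (@tens_trans (tens_neg s ++ (t ++ tens_neg t))).
  apply: tens_cat (tens_refl _) (tens_sym _).
  exact: tens_trans (tens_comm _ _) (tens_negK t).
rewrite catA -[X in tens_rel _ X]cat0s; apply: tens_cat (tens_refl _).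
exact: tens_trans (tens_cat (tens_refl _) (tens_sym st)) (tens_negK s).
Qed.

Definition tens_add (q r : tensor) : tensor := tens_pi (repr q ++ repr r).
Definition tens_opp (q : tensor) : tensor := tens_pi (tens_neg (repr q)).

Lemma tens_addE s t : tens_add (tens_pi s) (tens_pi t) = tens_pi (s ++ t).
Proof. by apply/tens_piP/tens_cat; apply/tens_piP; rewrite /tens_pi reprK. Qed.
Lemma tens_oppE s : tens_opp (tens_pi s) = tens_pi (tens_neg s).
Proof. by apply/tens_piP/tens_neg_rel/tens_piP; rewrite /tens_pi reprK. Qed.

Fact tens_addA : associative tens_add.
Proof.
move=> q r s; case: (tens_pi_surj q) => x <-; case: (tens_pi_surj r) => y <-.
by case: (tens_pi_surj s) => z <-; rewrite !tens_addE catA.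
Qed.
Fact tens_addC : commutative tens_add.
Proof.
move=> q r; case: (tens_pi_surj q) => x <-; case: (tens_pi_surj r) => y <-.
by rewrite !tens_addE; apply/tens_piP/tens_comm.
Qed.
Fact tens_add0 : left_id (tens_pi [::]) tens_add.
Proof. by move=> q; case: (tens_pi_surj q) => x <-; rewrite tens_addE. Qed.
Fact tens_addN : left_inverse (tens_pi [::]) tens_opp tens_add.
Proof.
move=> q; case: (tens_pi_surj q) => x <-; rewrite tens_oppE tens_addE.
exact/tens_piP/tens_negK.
Qed.
HB.instance Definition _ :=
  GRing.isZmodule.Build tensor tens_addA tens_addC tens_add0 tens_addN.

Lemma tens_piD s t : tens_pi (s ++ t) = tens_pi s + tens_pi t.
Proof. by rewrite -tens_addE. Qed.
End Tensor.

Section TensorMap.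
Variables (R : pzRingType) (X X' : lmodType R^c) (V V' : lmodType R).
Variables (f : {linear X -> X'}) (g : {linear V -> V'}).

Definition tens_fun (s : seq (X * V)) : seq (X' * V') :=
  [seq (f p.1, g p.2) | p <- s].

Lemma tens_fun_rel s t : tens_rel s t -> tens_rel (tens_fun s) (tens_fun t).
Proof.
elim=> {s t} /=; try by [move=> *; apply: tens_refl | move=> *; apply: tens_sym].
- by move=> t s u _ h _; apply: tens_trans h.
- by move=> s s' t t' _ h _ k; rewrite /tens_fun !map_cat; apply: tens_cat.
- by move=> s t; rewrite /tens_fun !map_cat; apply: tens_comm.
- by rewrite !linear0; apply: tens_0.
- by move=> x x' v; rewrite linearD; apply: tens_addl.
- by move=> x v v'; rewrite linearD; apply: tens_addr.
- by move=> x r v; rewrite !linearZ /=; apply: tens_balanced.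
Qed.

Definition tens_map (q : tensor X V) : tensor X' V' := tens_pi (tens_fun (repr q)).

Lemma tens_mapE s : tens_map (tens_pi s) = tens_pi (tens_fun s).
Proof. by apply/tens_piP/tens_fun_rel/tens_piP; rewrite /tens_pi reprK. Qed.

Fact tens_map_zmod : zmod_morphism tens_map.
Proof.
have D q r : tens_map (q + r) = tens_map q + tens_map r.
  case: (tens_pi_surj q) => x <-; case: (tens_pi_surj r) => y <-.
  by rewrite -tens_piD !tens_mapE -tens_piD /tens_fun map_cat.
by move=> q r; apply/eqP; rewrite eq_sym subr_eq -D subrK.
Qed.
HB.instance Definition _ :=
  GRing.isZmodMorphism.Build (tensor X V) (tensor X' V') tens_map tens_map_zmod.
End TensorMap.

Lemma tens_map_id (R : pzRingType) (X : lmodType R^c) (V : lmodType R) q :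
  tens_map (idfun : {linear X -> X}) (idfun : {linear V -> V}) q = q.
Proof.
case: (tens_pi_surj q) => s <-; rewrite tens_mapE; congr tens_pi.
by rewrite /tens_fun -[RHS]map_id; apply: eq_map => -[].
Qed.

Lemma tens_map_comp (R : pzRingType) (X X' X'' : lmodType R^c) (V V' V'' : lmodType R)
    (f : {linear X -> X'}) (f' : {linear X' -> X''})
    (g : {linear V -> V'}) (g' : {linear V' -> V''}) q :
  tens_map f' g' (tens_map f g q) = tens_map (f' \o f) (g' \o g) q.
Proof.
by case: (tens_pi_surj q) => s <-; rewrite !tens_mapE /tens_fun -map_comp.
Qed.

Lemma tens_map_swap (R : pzRingType) (X X' : lmodType R^c) (V V' : lmodType R)
    (f : {linear X -> X'}) (g : {linear V -> V'}) q :
  tens_map f (idfun : {linear V' -> V'}) (tens_map (idfun : {linear X -> X}) g q) =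
  tens_map (idfun : {linear X' -> X'}) g (tens_map f (idfun : {linear V -> V}) q).
Proof. by rewrite !tens_map_comp; case: (tens_pi_surj q) => s <-; rewrite !tens_mapE. Qed.

(** ker g / im f; the composite g f is not required to vanish, so this is
    ker g / (ker g /\ im f) in general. *)

Section Homology.
Variables (A B C : zmodType) (f : {additive A -> B}) (g : {additive B -> C}).

Definition boundary : {pred zker g} := fun z => val z \in im_pred f.
Fact boundary_zmod_closed : zmod_closed boundary.
Proof.
split=> [|x y hx hy]; first by change (val (0 : zker g) \in im_pred f); rewrite raddf0 rpred0.
by change (val (x - y) \in im_pred f); rewrite raddfB rpredB.
Qed.
HB.instance Definition _ :=
  GRing.isZmodClosed.Build (zker g) boundary boundary_zmod_closed.

Definition homology := Quotient.quot (boundary : zmodClosed (zker g)).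
HB.instance Definition _ := GRing.Zmodule.on homology.

Definition hclass (z : zker g) : homology := \pi_homology z.

Lemma hclass_eq z z' : hclass z = hclass z' <-> exists a, f a = val z - val z'.
Proof.
rewrite /hclass; split=> [/eqP|H].
  by rewrite -Quotient.idealrBE unfold_in raddfB => /im_predP.
by apply/eqP; rewrite -Quotient.idealrBE unfold_in raddfB; apply/im_predP.
Qed.
Lemma hclass_surj q : exists z, hclass z = q.
Proof. by exists (repr q); rewrite /hclass reprK. Qed.
Lemma hclassB x y : hclass (x - y) = hclass x - hclass y.
Proof. by rewrite /hclass !piE. Qed.
End Homology.

Section HomologyMap.
Variables (A B C A' B' C' : zmodType).
Variables (f : {additive A -> B}) (g : {additive B -> C}).
Variables (f' : {additive A' -> B'}) (g' : {additive B' -> C'}).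
Variables (hA : {additive A -> A'}) (hB : {additive B -> B'}) (hC : {additive C -> C'}).
Hypothesis hg : forall b, hC (g b) = g' (hB b).

Fact hmap_ker (z : zker g) : hB (val z) \in ker_pred g'.
Proof.
by case: z => z /=; rewrite !unfold_in -hg => /eqP->; rewrite raddf0.
Qed.
Definition hmap_cycle (z : zker g) : zker g' := Sub (hB (val z)) (hmap_ker z).
Definition hmap of (forall a, hB (f a) = f' (hA a)) :=
  fun q : homology f g => hclass f' (hmap_cycle (repr q)).

Hypothesis hf : forall a, hB (f a) = f' (hA a).

Lemma hmapE z : hmap hf (hclass f z) = hclass f' (hmap_cycle z).
Proof.
have /hclass_eq[a e] : hclass f (repr (hclass f z)) = hclass f z.
  by rewrite /hclass reprK.
by apply/hclass_eq; exists (hA a); rewrite /= -hf e raddfB.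
Qed.

Fact hmap_zmod : zmod_morphism (hmap hf).
Proof.
move=> q r; case: (hclass_surj q) => x <-; case: (hclass_surj r) => y <-.
rewrite -hclassB !hmapE -hclassB; congr hclass.
by apply: val_inj; rewrite raddfB /= -raddfB.
Qed.
HB.instance Definition _ :=
  GRing.isZmodMorphism.Build (homology f g) (homology f' g') (hmap hf) hmap_zmod.
End HomologyMap.

Record resolution (R : pzRingType) (M : lmodType R) := Resolution {
  res_obj : nat -> lmodType R;
  res_d k : {linear res_obj k.+1 -> res_obj k};
  res_aug : {linear res_obj 0 -> M};
  res_proj k : projective (res_obj k);
  res_augP m : exists x, res_aug x = m;
  res_exact0 x : res_aug x = 0 <-> exists y, res_d 0 y = x;
  res_exactS k x : res_d k x = 0 <-> exists y, res_d k.+1 y = x }.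

Section Tor.
Variables (R : pzRingType) (M : lmodType R) (P : resolution M).

(** The differential of P leaving degree k, which is 0 for k = 0. *)

Definition res_out k : {linear res_obj P k -> res_obj P k.-1} :=
  match k with 0 => \0 | k'.+1 => res_d P k' end.

Definition tor_in (X : lmodType R^c) k :
  {additive tensor X (res_obj P k.+1) -> tensor X (res_obj P k)} :=
  tens_map idfun (res_d P k).
Definition tor_out (X : lmodType R^c) k :
  {additive tensor X (res_obj P k) -> tensor X (res_obj P k.-1)} :=
  tens_map idfun (res_out k).

Definition tor k (X : lmodType R^c) : zmodType := homology (tor_in X k) (tor_out X k).

Section TorMap.
Variables (k : nat) (X Y : lmodType R^c) (f : {linear X -> Y}).
Definition tor_map : {additive tor k X -> tor k Y} :=
  hmap (hC := tens_map f idfun)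
    (tens_map_swap f (res_out k)) (tens_map_swap f (res_d P k)).
End TorMap.
End Tor.

Record functor (R : pzRingType) := Functor {
  fun_obj :> fpmod R^c -> zmodType;
  fun_map (X Y : fpmod R^c) : {linear X -> Y} -> {additive fun_obj X -> fun_obj Y};
  fun_id (X : fpmod R^c) (x : fun_obj X) : fun_map (idfun : {linear X -> X}) x = x;
  fun_comp (X Y Z : fpmod R^c) (f : {linear X -> Y}) (g : {linear Y -> Z}) (x : fun_obj X) :
    fun_map (g \o f) x = fun_map g (fun_map f x) }.

Section TorFunctor.
Variables (R : pzRingType) (M : lmodType R) (P : resolution M) (k : nat).

Fact tor_map_id (X : fpmod R^c) x : tor_map P k (idfun : {linear X -> X}) x = x.
Proof.
case: (hclass_surj x) => z <-; rewrite /tor_map /= hmapE; congr hclass.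
by apply: val_inj; rewrite /= tens_map_id.
Qed.
Fact tor_map_comp (X Y Z : fpmod R^c) (f : {linear X -> Y}) (g : {linear Y -> Z}) x :
  tor_map P k (g \o f) x = tor_map P k g (tor_map P k f x).
Proof.
case: (hclass_surj x) => z <-; rewrite /tor_map /= !hmapE; congr hclass.
by apply: val_inj; rewrite /= tens_map_comp.
Qed.
Definition Tor : functor R :=
  @Functor R (fun X => tor P k X) (fun X Y f => tor_map P k f) tor_map_id tor_map_comp.
End TorFunctor.

Section Nat.
Variables (R : pzRingType) (F G : functor R).

Record nat_trans := NatTrans {
  nt_fun :> forall X : fpmod R^c, F X -> G X;
  nt_add (X : fpmod R^c) : {morph @nt_fun X : x y / x + y};
  nt_natural (X Y : fpmod R^c) (f : {linear X -> Y}) (x : F X) :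
    nt_fun (fun_map F f x) = fun_map G f (nt_fun x) }.

Lemma nat_transP (s t : nat_trans) : (forall X x, s X x = t X x) -> s = t.
Proof.
case: s t => [s sD sN] [t tD tN] /= st.
have e : s = t by apply/functional_extensionality_dep => X; apply/funext.
subst t; congr NatTrans; exact: Prop_irrelevance.
Qed.

Definition nt_zero : nat_trans.
Proof.
exists (fun X x => 0) => [X x y|X Y f x]; first by rewrite addr0.
by rewrite raddf0.
Defined.
Definition nt_opp (s : nat_trans) : nat_trans.
Proof.
exists (fun X x => - s X x) => [X x y|X Y f x]; first by rewrite nt_add opprD.
by rewrite nt_natural raddfN.
Defined.
Definition nt_plus (s t : nat_trans) : nat_trans.
Proof.
exists (fun X x => s X x + t X x) => [X x y|X Y f x]; first by rewrite !nt_add addrACA.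
by rewrite !nt_natural raddfD.
Defined.

Fact nt_addA : associative nt_plus.
Proof. by move=> s t u; apply: nat_transP => X x /=; rewrite addrA. Qed.
Fact nt_addC : commutative nt_plus.
Proof. by move=> s t; apply: nat_transP => X x /=; rewrite addrC. Qed.
Fact nt_add0 : left_id nt_zero nt_plus.
Proof. by move=> s; apply: nat_transP => X x /=; rewrite add0r. Qed.
Fact nt_addN : left_inverse nt_zero nt_opp nt_plus.
Proof. by move=> s; apply: nat_transP => X x /=; rewrite addNr. Qed.
Definition Nat : abgroup := AbGroup nt_addA nt_addC nt_add0 nt_addN.
End Nat.

(* Main.v *)
(** Let K be an n-th syzygy of M.  Both groups are the stable group Hom(K, Om) modulo
  the maps that factor through a projective.

  On the Ext side, every n-fold extension of M by Om is the push-out along some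
  f : K -> Om of the extension that computes K, and f is unique up to maps that extend
  over the projective term next to K.

  On the Tor side, let 0 -> L -> W -> K -> 0 and 0 -> L' -> W' -> Om -> 0 have projective
  middle terms.  Dimension shifting identifies Tor_(n+1)(-, M) with the kernel of
  - (x) L -> - (x) W, and similarly for N.  As W is a summand of some R^m, an element of
  this kernel is a solution of a finite linear system, so the functor is generated by one
  universal solution in X0 (x) L, with X0 finitely presented.  Evaluating a natural
  transformation there, and using naturality once more to get the relations of L, shows
  that it is induced by a map l : L -> L'.  Moreover a map out of L that induces 0
  on these kernels extends over W; hence l comes from some f : K -> Om, and f induces 0
  exactly when it factors through a projective. *)

Require Import Defs.
From mathcomp Require Import all_boot all_order all_algebra boolp.

Set Implicit Arguments.
Unset Strict Implicit.
Unset Printing Implicit Defensive.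

Import GRing.Theory.
Local Open Scope ring_scope.
Local Open Scope quotient_scope.

(** A map out of a syzygy represents an element on either side, without being a canonical
    representative of it, so the isomorphism is extracted from a correspondence. The equivalence in
    the third hypothesis makes it single-valued and injective at once. *)
Lemma group_iso_rel (G H : abgroup) (r : G -> H -> Prop) :
  (forall x, exists y, r x y) -> (forall y, exists x, r x y) ->
  (forall x x' y y', r x y -> r x' y' -> (x = x' <-> y = y')) ->
  (forall x x' y y', r x y -> r x' y' -> r (ab_add x x') (ab_add y y')) ->
  group_iso G H.
Proof.
move=> totl totr uniq radd.
have [phi phiP] := choice totl; have [psi psiP] := choice totr.
exists phi; split.
  exists psi => [x|y]; first exact/(uniq _ _ _ _ (psiP _) (phiP x)).
  exact/(uniq _ _ _ _ (phiP _) (psiP y)).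
by move=> x y; apply/(uniq _ _ _ _ (phiP _) (radd _ _ _ _ (phiP x) (phiP y))).
Qed.

(** * Extensions and maps out of a syzygy *)

Section Yoneda.
Variable R : pzRingType.
Implicit Types A B C D K L M N W : fpmod R.

Lemma cf_mor_sub B A B' A' (f f' : {linear B -> B'}) (g g' : {linear A -> A'})
    (x : conflation B A) (y : conflation B' A') :
  cf_mor f g x y -> cf_mor f' g' x y -> cf_mor (f \- f') (g \- g') x y.
Proof.
move=> [h [h1 h2]] [k [k1 k2]]; exists (h \- k); split=> [b|e] /=.
  by rewrite h1 k1 linearB.
by rewrite linearB h2 k2.
Qed.

Lemma ymor_sub n A B A' B' (f f' : {linear B -> B'}) (g g' : {linear A -> A'})
    (x : yext n A B) (y : yext n A' B') :
  ymor f g x y -> ymor f' g' x y -> ymor (f \- f') (g \- g') x y.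
Proof.
case: n x y => [|n] /= x y; first by move=> h k a; rewrite h k linearB.
elim: n B B' f f' x y => [|n IH] B B' f f' x y /=; first exact: cf_mor_sub.
move=> [k [h1 h2]] [k' [h1' h2']]; exists (k \- k'); split; last exact: IH.
exact: cf_mor_sub.
Qed.

Lemma cf_factor W B A (x : conflation B A) (h : {linear W -> cf_mid x}) :
  (forall w, cf_proj x (h w) = 0) ->
  exists u : {linear W -> B}, forall w, cf_inj x (u w) = h w.
Proof.
move=> ph; have /choice[u uE] w : exists b, cf_inj x b = h w by apply/cf_exact.
have ul : linear u.
  by move=> a v w; apply: (@cf_injP _ _ _ x); rewrite linearP /= !uE linearP.
by exists (lin_of ul).
Qed.

Lemma cf_descend W B A (x : conflation B A) (h : {linear cf_mid x -> W}) :
  (forall b, h (cf_inj x b) = 0) ->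
  exists u : {linear A -> W}, forall e, u (cf_proj x e) = h e.
Proof.
move=> hi; have [s sE] := choice (cf_projP x).
have hs e e' : cf_proj x e = cf_proj x e' -> h e = h e'.
  move=> /eqP; rewrite -subr_eq0 -linearB => /eqP/cf_exact[b be].
  by apply/eqP; rewrite -subr_eq0 -linearB -be hi.
have ul : linear (h \o s).
  by move=> a v w /=; rewrite -linearP; apply: hs; rewrite linearP !sE.
by exists (lin_of ul) => e /=; apply: hs; rewrite sE.
Qed.

Lemma cf_mor_lift B A B' A' (x : conflation B A) (y : conflation B' A')
    (g : {linear A -> A'}) :
  fp_projective (cf_mid x) -> exists f : {linear B -> B'}, cf_mor f g x y.
Proof.
move=> projx; have [h hE] := projx _ _ y (g \o cf_proj x).
have [f fE] : exists f : {linear B -> B'}, forall b, cf_inj y (f b) = (h \o cf_inj x) b.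
  by apply: cf_factor => b; rewrite /= hE /= cf_projK linear0.
by exists f, h; split.
Qed.

(** Over the zero map on the right end, the middle map lands in the kernel of [cf_proj y], hence
    comes from a map into B'. *)
Lemma cf_mor0_extend B A B' A' (x : conflation B A) (y : conflation B' A')
    (f : {linear B -> B'}) :
  cf_mor f \0 x y -> exists u : {linear cf_mid x -> B'}, f =1 u \o cf_inj x.
Proof.
move=> [h [h1 h2]]; have [u uE] := cf_factor h2.
by exists u => b; apply: (@cf_injP _ _ _ y); rewrite -h1 /= uE.
Qed.

(** The maps that vanish in the stable category modulo projectives. *)
Definition proj_factoring A B (f : A -> B) : Prop :=
  exists W (u : {linear A -> W}) (v : {linear W -> B}),
    fp_projective W /\ f =1 v \o u.

Lemma proj_factoring0 A B : proj_factoring (\0 : A -> B).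
Proof.
exists (fp_free R 0), \0, \0; split; first exact: fp_projective_free.
by [].
Qed.

Lemma proj_factoringD A B (f g : A -> B) :
  proj_factoring f -> proj_factoring g -> proj_factoring (f \+ g).
Proof.
move=> [W [u [v [pW fE]]]] [W' [u' [v' [pW' gE]]]].
exists (fp_prod W W'), (pair_map u u'), (copair v v'); split.
  exact: fp_projective_prod.
by move=> a; rewrite /= fE gE.
Qed.

Lemma proj_factoringN A B (f : A -> B) : proj_factoring f -> proj_factoring (\- f).
Proof.
move=> [W [u [v [pW fE]]]]; exists W, u, (\- v); split=> // a.
by rewrite /= fE.
Qed.

Fixpoint yprojS n A B : yextS n A B -> Prop :=
  match n with
  | 0 => fun x => fp_projective (cf_mid x)
  | n'.+1 => fun x => fp_projective (cf_mid (projT2 x).1) /\ yprojS (projT2 x).2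
  end.

(** The comparison theorem. The lift starts at the right end, so the inner splice is treated before
    the leftmost conflation. *)
Lemma ymorS_lift n A B A' B' (x : yextS n A B) (y : yextS n A' B')
    (g : {linear A -> A'}) :
  yprojS x -> exists f : {linear B -> B'}, ymorS f g x y.
Proof.
elim: n B B' x y => [|n IH] B B' /= x y; first exact: cf_mor_lift.
move=> [px px']; have [k kE] := IH _ _ _ (projT2 y).2 px'.
by have [f fE] := cf_mor_lift (projT2 y).1 k px; exists f, k.
Qed.

Definition yleft_mid n A B : yextS n A B -> fpmod R :=
  match n with
  | 0 => fun x => cf_mid x
  | _.+1 => fun x => cf_mid (projT2 x).1
  end.

Definition yleft_inj n A B : forall x : yextS n A B, {linear B -> yleft_mid x} :=
  match n with
  | 0 => fun x => cf_inj x
  | _.+1 => fun x => cf_inj (projT2 x).1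
  end.

Lemma yprojS_left n A B (x : yextS n A B) : yprojS x -> fp_projective (yleft_mid x).
Proof. by case: n x => [|n] x //= []. Qed.

(** A lift of zero is null-homotopic, and u is the leftmost component of the homotopy. *)
Lemma ymorS0_extend n A B A' B' (x : yextS n A B) (y : yextS n A' B')
    (f : {linear B -> B'}) :
  yprojS x -> ymorS f \0 x y ->
  exists u : {linear yleft_mid x -> B'}, f =1 u \o yleft_inj x.
Proof.
elim: n B B' f x y => [|n IH] B B' f /= x y; first by move=> _; apply: cf_mor0_extend.
move=> [px px'] [k [[h [h1 h2]]]] /(IH _ _ _ _ _ px')[s sE].
have [t tE] := yprojS_left px' (projT2 y).1 s.
pose j := yleft_inj (projT2 x).2.
(* [t] lifts the homotopy component [s] of the inner splice; subtracting its contribution makes [h]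
   land in the kernel of the deflation. *)
have [|u uE] := @cf_factor _ _ _ (projT2 y).1 (h \- (t \o (j \o cf_proj (projT2 x).1))).
  by move=> w; rewrite /= linearB h2 tE sE subrr.
exists u => b; apply: (@cf_injP _ _ _ (projT2 y).1).
by rewrite uE /= h1 cf_projK raddf0 raddf0 subr0.
Qed.

(** Holds of [idfun] for n = 0, and of an n-fold extension with projective middle terms
  for n > 0. *)
Definition syzygy_ext n M K (e : yext n M K) : Prop :=
  forall L (x : yext n M L),
    (exists f : {linear K -> L}, ymor f idfun e x) /\
    (forall f f' : {linear K -> L}, ymor f idfun e x -> ymor f' idfun e x ->
       proj_factoring (f \- f')).

(** Two lifts of the identity of M differ by a lift of zero, which extends over the projective term
    next to K. *)
Lemma yprojS_syzygy_ext n M K (e : yextS n M K) :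
  yprojS e -> syzygy_ext (n := n.+1) e.
Proof.
move=> pe L x; split=> [|f f' ef ef']; first exact: ymorS_lift.
have /(ymorS0_extend pe)[u uE] : ymorS (f \- f') \0 e x.
  by apply: (ymor_ext (n := n.+1)) (ymor_sub ef ef') => // a /=; rewrite subrr.
by exists (yleft_mid e), (yleft_inj e), u; split=> //; apply: yprojS_left.
Qed.

Lemma projective_fp A : projective A -> fp_projective A.
Proof. by move=> pA B C x f; apply: pA => w; apply: cf_projP. Qed.

Lemma syzygy_ext_exists n M : enough_projectives R ->
  exists K (e : yext n M K), is_syzygy M n K /\ syzygy_ext e.
Proof.
move=> hR; case: n => [|n].
  (* In degree 0 the map f must equal x pointwise, so two choices differ by the zero map. *)
  exists M, (idfun : {linear M -> M}); split; first exact: syzygy0.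
  move=> L x; split=> [|f f' /= ff' ff]; first by exists x.
  have [W [u [v [pW E]]]] := proj_factoring0 M L.
  exists W, u, v; split=> // a; rewrite -E /=.
  by have /= -> := ff' a; have /= -> := ff a; rewrite subrr.
suff [K [e [Ke /yprojS_syzygy_ext ?]]] :
  exists K (e : yextS n M K), is_syzygy M n.+1 K /\ yprojS e by exists K, e.
elim: n => [|n [K [e [Ke pe]]]].
  have [K [c /projective_fp pc]] := hR M; exists K, c; split=> //.
  exact: syzygyS (syzygy0 _) pc.
have [L [c /projective_fp pc]] := hR K.
by exists L, (existT _ K (c, e)); split=> //; apply: syzygyS Ke pc.
Qed.

(** * Ext modulo projectives as a stable Hom group *)

Section StableHom.
Variables (n : nat) (M K : fpmod R) (e : yext n M K).
Hypothesis eP : syzygy_ext e.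

Definition ext_cls L (f : {linear K -> L}) : Ext n M L := qpi (@yeqrel R n M L) (ypush f e).

Lemma ext_cls_surj L (x : Ext n M L) : exists f, x = ext_cls f.
Proof.
have [y <-] := qpi_surj x; have [[f ef] _] := eP y.
by exists f; apply/esym/qpiP/yeqv_push.
Qed.

Lemma ext_clsD L (f g : {linear K -> L}) :
  ext_cls (f \+ g) = ab_add (ext_cls f) (ext_cls g).
Proof. by rewrite /= ext_addE; apply/esym/qpiP/ypush_addl. Qed.

Lemma ext_clsN L (f : {linear K -> L}) : ext_cls (\- f) = ab_opp (ext_cls f).
Proof.
rewrite /= ext_oppE; apply/esym/qpiP.
by apply: yeqv_trans (ypush_comp _ _ _) _; apply: ypush_ext.
Qed.

Lemma ext_push_cls L L' (f : {linear K -> L}) (g : {linear L -> L'}) :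
  ext_push g (ext_cls f) = ext_cls (g \o f).
Proof. by rewrite ext_pushE; apply/qpiP/ypush_comp. Qed.

Lemma ext_cls_ext L (f g : {linear K -> L}) : f =1 g -> ext_cls f = ext_cls g.
Proof. by move=> fg; apply/qpiP/ypush_ext. Qed.

(** Induction along the zigzag: a morphism from x to y that is the identity on both ends turns a map
    from e to x into one from e to y with the same left end. In the transitive case a map [h] to the
    intermediate extension is inserted. *)
Lemma yeqv_proj_factoring L (x y : yext n M L) (f g : {linear K -> L}) :
  yeqv x y -> ymor f idfun e x -> ymor g idfun e y -> proj_factoring (f \- g).
Proof.
move=> xy; elim: xy f g => {x y} [x y xy|x|x y _ IH|y x z _ IH1 _ IH2] f g ex ey.
- by apply: (eP y).2 ey; apply: ymor_ext (ymor_comp ex xy).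
- exact: (eP x).2 ex ey.
- have [W [u [v [pW E]]]] := proj_factoringN (IH _ _ ey ex).
  by exists W, u, v; split=> // a; rewrite -E /= opprB.
- have [[h eh] _] := eP y.
  have [W [u [v [pW E]]]] := proj_factoringD (IH1 _ _ ex eh) (IH2 _ _ eh ey).
  by exists W, u, v; split=> // a; rewrite -E /= addrA subrK.
Qed.

Lemma ext_cls_eq L (f g : {linear K -> L}) :
  qpi (coset_eqrel (proj_factor_group n M L)) (ext_cls f) =
    qpi (coset_eqrel (proj_factor_group n M L)) (ext_cls g) <->
  proj_factoring (f \- g).
Proof.
have clsB : ab_add (ext_cls f) (ab_opp (ext_cls g)) = ext_cls (f \- g).
  by rewrite -ext_clsN -ext_clsD; apply: ext_cls_ext.
rewrite qpiP; change (proj_factor (ab_add (ext_cls f) (ab_opp (ext_cls g))) <->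
  proj_factoring (f \- g)); rewrite clsB; split.
  (* [beta] is itself the class of some u : K -> W. Thus f - g and v u have the same class, so they
     differ by a map that factors through a projective, and v u is another such map. *)
  move=> [W [v [beta [pW]]]]; have [u ->] := ext_cls_surj beta.
  rewrite ext_push_cls => /qpiP /= eqv.
  have := yeqv_proj_factoring eqv (ypush_mor _ _) (ypush_mor _ _).
  have vu : proj_factoring (v \o u) by exists W, u, v.
  move=> /proj_factoringD/(_ vu)[W' [u' [v' [pW' E]]]].
  by exists W', u', v'; split=> // a; rewrite -E /= subrK.
move=> [W [u [v [pW E]]]]; exists W, v, (ext_cls u); split=> //.
by rewrite ext_push_cls; apply: ext_cls_ext.
Qed.
End StableHom.
End Yoneda.

(** * Tensor products *)

Section TensorElements.
Variables (R : pzRingType) (X : lmodType R^c) (V : lmodType R).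

Definition tens1 (x : X) (v : V) : tensor X V := tens_pi [:: (x, v)].

Lemma tens1Dl x x' v : tens1 (x + x') v = tens1 x v + tens1 x' v.
Proof. by rewrite -tens_piD; apply/tens_piP/tens_addl. Qed.
Lemma tens1Dr x v v' : tens1 x (v + v') = tens1 x v + tens1 x v'.
Proof. by rewrite -tens_piD; apply/tens_piP/tens_addr. Qed.
Lemma tens1Z x (r : R) v : tens1 ((r : R^c) *: x) v = tens1 x (r *: v).
Proof. exact/tens_piP/tens_balanced. Qed.
Lemma tens10l v : tens1 0 v = 0.
Proof. exact/tens_piP/tens_pair0. Qed.
Lemma tens10r x : tens1 x 0 = 0.
Proof. by apply: (@addIr _ (tens1 x 0)); rewrite -tens1Dr addr0 add0r. Qed.
Lemma tens1_suml I (r : seq I) (F : I -> X) v :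
  tens1 (\sum_(i <- r) F i) v = \sum_(i <- r) tens1 (F i) v.
Proof.
elim: r => [|i r IH]; first by rewrite !big_nil tens10l.
by rewrite !big_cons tens1Dl IH.
Qed.
Lemma tens1_sumr I (r : seq I) (F : I -> V) x :
  tens1 x (\sum_(i <- r) F i) = \sum_(i <- r) tens1 x (F i).
Proof.
elim: r => [|i r IH]; first by rewrite !big_nil tens10r.
by rewrite !big_cons tens1Dr IH.
Qed.

Lemma tens_piE s : tens_pi s = \sum_(p <- s) tens1 p.1 p.2.
Proof.
elim: s => [|[x v] s IH]; first by rewrite big_nil.
by rewrite big_cons -IH -tens_piD.
Qed.

Lemma tens_ind (S : tensor X V -> Prop) :
  S 0 -> (forall x v t, S t -> S (tens1 x v + t)) -> forall t, S t.
Proof.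
move=> S0 S1 t; have [s <-] := tens_pi_surj t; rewrite tens_piE.
by elim: s => [|p s IH]; rewrite ?big_nil ?big_cons //; apply: S1.
Qed.

Section Rec.
Variables (Z : zmodType) (phi : X -> V -> Z).
Hypothesis phiDl : forall x x' v, phi (x + x') v = phi x v + phi x' v.
Hypothesis phiDr : forall x v v', phi x (v + v') = phi x v + phi x v'.
Hypothesis phiZ : forall x (r : R) v, phi ((r : R^c) *: x) v = phi x (r *: v).

Let phi_seq (s : seq (X * V)) := \sum_(p <- s) phi p.1 p.2.

Let phi_seq_rel s t : tens_rel s t -> phi_seq s = phi_seq t.
Proof.
elim=> {s t} //.
- by move=> s t u _ -> _ ->.
- by move=> s s' t t' _ e _ e'; rewrite /phi_seq !big_cat /= -/(phi_seq s) e -/(phi_seq t) e'.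
- by move=> s t; rewrite /phi_seq !big_cat /= addrC.
- rewrite /phi_seq big_seq1 big_nil /=.
  by apply: (@addIr _ (phi 0 0)); rewrite -phiDl addr0 add0r.
- by move=> x x' v; rewrite /phi_seq big_seq1 !big_cons big_nil /= addr0 phiDl.
- by move=> x v v'; rewrite /phi_seq big_seq1 !big_cons big_nil /= addr0 phiDr.
- by move=> x r v; rewrite /phi_seq !big_seq1 /= phiZ.
Qed.

(** The universal property of the tensor product: summing [phi] over a formal sum respects each
    generator of the congruence. *)
Lemma tens_rec : exists F : tensor X V -> Z,
  {morph F : t u / t + u} /\ forall x v, F (tens1 x v) = phi x v.
Proof.
have FE s : phi_seq (repr (tens_pi s)) = phi_seq s.
  by apply/phi_seq_rel/tens_piP; rewrite /tens_pi reprK.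
exists (fun t => phi_seq (repr t)); split=> [t u|x v].
  have [s <-] := tens_pi_surj t; have [s' <-] := tens_pi_surj u.
  by rewrite -tens_piD !FE /phi_seq big_cat.
by rewrite FE /phi_seq big_seq1.
Qed.
End Rec.
End TensorElements.

Lemma tens_map1 (R : pzRingType) (X X' : lmodType R^c) (V V' : lmodType R)
    (f : {linear X -> X'}) (g : {linear V -> V'}) x v :
  tens_map f g (tens1 x v) = tens1 (f x) (g v).
Proof. exact: tens_mapE. Qed.

Section TensorMaps.
Variables (R : pzRingType) (X X' : lmodType R^c) (V V' : lmodType R).

Lemma tens_map_ext (f f' : {linear X -> X'}) (g g' : {linear V -> V'}) t :
  f =1 f' -> g =1 g' -> tens_map f g t = tens_map f' g' t.
Proof.
move=> ff gg; elim/tens_ind: t => [|x v t IH]; first by rewrite !raddf0.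
by rewrite !raddfD /= IH !tens_map1 ff gg.
Qed.

Lemma tens_map_add (f : {linear X -> X'}) (g h : {linear V -> V'}) t :
  tens_map f (g \+ h) t = tens_map f g t + tens_map f h t.
Proof.
elim/tens_ind: t => [|x v t IH]; first by rewrite !raddf0 addr0.
by rewrite !raddfD /= IH !tens_map1 /= tens1Dr addrACA.
Qed.

Lemma tens_map_sub (f : {linear X -> X'}) (g h : {linear V -> V'}) t :
  tens_map f (g \- h) t = tens_map f g t - tens_map f h t.
Proof.
apply/eqP; rewrite eq_sym subr_eq -tens_map_add; apply/eqP.
by apply: tens_map_ext => // v /=; rewrite subrK.
Qed.

Lemma tens_map0r (f : {linear X -> X'}) t : tens_map f (\0 : {linear V -> V'}) t = 0.
Proof.
elim/tens_ind: t => [|x v t IH]; first by rewrite !raddf0.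
by rewrite raddfD /= IH tens_map1 tens10r addr0.
Qed.

Lemma tens_map_surj (f : {linear X -> X'}) (g : {linear V -> V'}) :
  (forall x, exists y, f y = x) -> (forall v, exists w, g w = v) ->
  forall t, exists u, tens_map f g u = t.
Proof.
move=> fs gs; apply: tens_ind => [|x v t [u <-]]; first by exists 0; rewrite raddf0.
have [y <-] := fs x; have [w <-] := gs v.
by exists (tens1 y w + u); rewrite raddfD /= tens_map1.
Qed.

(** The kernel of [f (x) g], for surjective f and g, is generated by the elementary
  tensors [x (x) v] with [f x = 0] or [g v = 0]: modulo these, [f x (x) g v |-> x (x) v]
  is a well-defined inverse. *)
Lemma tens_map_ker (f : {linear X -> X'}) (g : {linear V -> V'})
    (S : zmodClosed (tensor X V)) :
  (forall x, exists y, f y = x) -> (forall v, exists w, g w = v) ->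
  (forall x v, f x = 0 -> tens1 x v \in S) -> (forall x v, g v = 0 -> tens1 x v \in S) ->
  forall t, tens_map f g t = 0 -> t \in S.
Proof.
move=> /choice[a aE] /choice[b bE] Sl Sr.
pose q (t : tensor X V) : Quotient.quot S := \pi_(Quotient.quot S) t.
have qE t u : q t = q u <-> t - u \in S.
  by split=> [/eqP|tu]; [|apply/eqP]; rewrite -Quotient.idealrBE.
have qD t u : q (t + u) = q t + q u by rewrite /q !piE.
have ql x x' v : f x = f x' -> q (tens1 x v) = q (tens1 x' v).
  move=> fx; have -> : tens1 x v = tens1 (x - x') v + tens1 x' v by rewrite -tens1Dl subrK.
  by apply/qE; rewrite addrK; apply: Sl; rewrite linearB fx subrr.
have qr x v v' : g v = g v' -> q (tens1 x v) = q (tens1 x v').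
  move=> gv; have -> : tens1 x v = tens1 x (v - v') + tens1 x v' by rewrite -tens1Dr subrK.
  by apply/qE; rewrite addrK; apply: Sr; rewrite linearB gv subrr.
have [|||F [FD FE]] := @tens_rec R X' V' _ (fun x v => q (tens1 (a x) (b v))).
- by move=> x x' v; rewrite -qD -tens1Dl; apply: ql; rewrite linearD !aE.
- by move=> x v v'; rewrite -qD -tens1Dr; apply: qr; rewrite linearD !bE.
- move=> x r v; transitivity (q (tens1 ((r : R^c) *: a x) (b v))).
    by apply: ql; rewrite linearZ /= !aE.
  by rewrite tens1Z; apply: qr; rewrite linearZ /= !bE.
have F0 : F 0 = 0 by apply: (@addIr _ (F 0)); rewrite -FD !add0r.
have FK t : F (tens_map f g t) = q t.
  elim/tens_ind: t => [|x v t IH]; first by rewrite raddf0 F0 /q piE.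
  rewrite raddfD /= tens_map1 FD FE IH qD; congr (_ + _).
  by rewrite (ql _ x) ?aE //; apply: qr; rewrite bE.
move=> t t0; have := FK t; rewrite t0 F0 => /esym q0.
have -> : t = t - 0 by rewrite subr0.
by apply/qE; rewrite q0 /q piE.
Qed.
End TensorMaps.

Lemma tens_map_compr (R : pzRingType) (X : lmodType R^c) (U V W : lmodType R)
    (f : {linear U -> V}) (g : {linear V -> W}) (t : tensor X U) :
  tens_map idfun (g \o f) t = tens_map idfun g (tens_map idfun f t).
Proof. by rewrite tens_map_comp; apply: tens_map_ext. Qed.

(** Right exactness, obtained from [tens_map_ker] by taking for S the image of f. *)
Lemma tens_exact_r (R : pzRingType) (X : lmodType R^c) (U V W : lmodType R)
    (f : {linear U -> V}) (g : {linear V -> W}) :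
  (forall w, exists v, g v = w) -> (forall v, g v = 0 -> exists u, f u = v) ->
  forall t : tensor X V, tens_map idfun g t = 0 -> exists s : tensor X U, tens_map idfun f s = t.
Proof.
move=> gs ex t t0; apply/(@im_predP _ _ (tens_map (idfun : {linear X -> X}) f)).
apply: (tens_map_ker _ gs _ _ t0) => [x|x v /= ->|x v /ex[u <-]]; first by exists x.
  by rewrite tens10l rpred0.
by apply/im_predP; exists (tens1 x u); rewrite /= tens_map1.
Qed.

Lemma tens_exact_l (R : pzRingType) (X Y Z : lmodType R^c) (V : lmodType R)
    (f : {linear X -> Y}) (g : {linear Y -> Z}) :
  (forall z, exists y, g y = z) -> (forall y, g y = 0 -> exists x, f x = y) ->
  forall t : tensor Y V, tens_map g idfun t = 0 -> exists s : tensor X V, tens_map f idfun s = t.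
Proof.
move=> gs ex t t0; apply/(@im_predP _ _ (tens_map f (idfun : {linear V -> V}))).
apply: (tens_map_ker gs _ _ _ t0) => [v|y v /ex[x <-]|y v /= ->]; first by exists v.
  by apply/im_predP; exists (tens1 x v); rewrite /= tens_map1.
by rewrite tens10r rpred0.
Qed.

(** * Coordinates in tensor products with free modules *)

Section FreeTensor.
Variables (R : pzRingType) (q : nat).

Lemma tens_span_r (X : lmodType R^c) (V : lmodType R) (g : {linear 'rV[R]_q -> V}) :
  (forall v, exists w, g w = v) -> forall t : tensor X V,
  exists x : 'I_q -> X, t = \sum_j tens1 (x j) (g (delta_mx 0 j)).
Proof.
move=> gs; apply: tens_ind => [|x v t [y ->]].
  by exists (fun=> 0); rewrite big1 // => j _; rewrite tens10l.
have [w <-] := gs v; exists (fun j => (w 0 j : R^c) *: x + y j).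
rewrite {1}(row_sum_delta w) linear_sum tens1_sumr -big_split; apply: eq_bigr => j _ /=.
by rewrite tens1Dl linearZ tens1Z.
Qed.

Lemma tens_span_l (X : lmodType R^c) (V : lmodType R) (g : {linear 'rV[R^c]_q -> X}) :
  (forall x, exists w, g w = x) -> forall t : tensor X V,
  exists v : 'I_q -> V, t = \sum_j tens1 (g (delta_mx 0 j)) (v j).
Proof.
move=> gs; apply: tens_ind => [|x v t [y ->]].
  by exists (fun=> 0); rewrite big1 // => j _; rewrite tens10r.
have [w <-] := gs x; exists (fun j => (w 0 j : R) *: v + y j).
rewrite {1}(row_sum_delta w) linear_sum tens1_suml -big_split; apply: eq_bigr => j _ /=.
by rewrite tens1Dr linearZ tens1Z.
Qed.

(** The balanced map (x, w) |-> x w_j induces the j-th coordinate of the isomorphism of X (x) R^q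
    with X^q. *)
Lemma tens_coord_r (X : lmodType R^c) (x : 'I_q -> X) :
  \sum_j tens1 (x j) (delta_mx 0 j : 'rV[R]_q) = 0 -> forall j, x j = 0.
Proof.
move=> s0 j; have [|||F [FD FE]] :=
  @tens_rec R X 'rV[R]_q X (fun x w => (w 0 j : R^c) *: x).
- by move=> y y' w; rewrite scalerDr.
- by move=> y w w'; rewrite mxE scalerDl.
- by move=> y r w; rewrite mxE scalerA.
have F0 : F 0 = 0 by apply: (@addIr _ (F 0)); rewrite -FD !add0r.
have := congr1 F s0; rewrite F0 (big_morph F FD F0) (bigD1 j) //= FE mxE !eqxx scale1r.
by rewrite big1 ?addr0 // => k kj; rewrite FE mxE eq_sym (negbTE kj) andbF scale0r.
Qed.

Lemma tens_coord_l (V : lmodType R) (v v' : 'I_q -> V) :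
  \sum_j tens1 (delta_mx 0 j : 'rV[R^c]_q) (v j) =
    \sum_j tens1 (delta_mx 0 j : 'rV[R^c]_q) (v' j) -> v =1 v'.
Proof.
move=> vv' j; have [|||F [FD FE]] :=
  @tens_rec R 'rV[R^c]_q V V (fun w v => (w 0 j : R) *: v).
- by move=> w w' y; rewrite mxE scalerDl.
- by move=> w y y'; rewrite scalerDr.
- by move=> w r y; rewrite mxE scalerA.
have F0 : F 0 = 0 by apply: (@addIr _ (F 0)); rewrite -FD !add0r.
have FK u : F (\sum_j tens1 (delta_mx 0 j : 'rV[R^c]_q) (u j)) = u j.
  rewrite (big_morph F FD F0) (bigD1 j) //= FE mxE !eqxx scale1r.
  by rewrite big1 ?addr0 // => k kj; rewrite FE mxE eq_sym (negbTE kj) andbF scale0r.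
by rewrite -FK vv' FK.
Qed.
End FreeTensor.

Lemma rV_comb (S : pzRingType) (V : lmodType S) q (x : 'I_q -> V) :
  exists h : {linear 'rV[S]_q -> V}, forall w, h w = \sum_j w 0 j *: x j.
Proof.
pose k (w : 'rV[S]_q) := \sum_j w 0 j *: x j.
have kl : linear k.
  move=> a u v; rewrite /k scaler_sumr -big_split; apply: eq_bigr => j _ /=.
  by rewrite !mxE scalerDl scalerA.
by exists (lin_of kl).
Qed.

Lemma rV_comb_delta (S : pzRingType) (V : lmodType S) q (x : 'I_q -> V)
    (h : 'rV[S]_q -> V) :
  (forall w, h w = \sum_j w 0 j *: x j) -> forall j, h (delta_mx 0 j) = x j.
Proof.
move=> hE j; rewrite hE (bigD1 j) //= mxE !eqxx scale1r big1 ?addr0 // => i ij.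
by rewrite mxE eqxx (negbTE ij) scale0r.
Qed.

(** * Natural transformations between kernels of tensor functors *)

Section KernelFunctor.
Variables (R : pzRingType) (L V : lmodType R).

(** Identifies F with the functor X |-> ker (X (x) L -> X (x) V) by a natural embedding into X (x)
    L, so that the kernels need not be organised into a functor of their own. *)
Record ker_functor (F : functor R) (i : {linear L -> V})
    (e : forall X : fpmod R^c, F X -> tensor X L) : Prop := KerFunctor {
  kf_add (X : fpmod R^c) : {morph e X : x y / x + y};
  kf_inj (X : fpmod R^c) : injective (e X);
  kf_im (X : fpmod R^c) (z : tensor X L) : tens_map idfun i z = 0 <-> exists x, e X x = z;
  kf_nat (X Y : fpmod R^c) (h : {linear X -> Y}) x :
    e Y (fun_map F h x) = tens_map h idfun (e X x) }.

Lemma ker_functor0 (F : functor R) (i : {linear L -> V})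
    (e : forall X : fpmod R^c, F X -> tensor X L) (X : fpmod R^c) :
  ker_functor i e -> e X 0 = 0.
Proof. by move=> /kf_add eD; apply: (@addIr _ (e X 0)); rewrite -eD !add0r. Qed.
End KernelFunctor.

(** [X |-> ker (X (x) L -> X (x) R^m)] is generated, as a functor on mod-R, by the single
  element [sum_j x_j (x) y_j], where the y_j generate L and the x_j are the universal
  solution of the linear system [sum_j x_j (iota y_j)_l = 0]. *)

Section KernelGenerator.
Variables (R : pzRingType) (L : lmodType R) (q m : nat).
Variables (g : {linear 'rV[R]_q -> L}) (iota : {linear L -> 'rV[R]_m}).
Hypothesis g_surj : forall y, exists w, g w = y.

Let y (j : 'I_q) : L := g (delta_mx 0 j).

Definition gen_relations : 'M[R^c]_(m, q) := \matrix_(l, j) iota (y j) 0 l.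
Definition gen_map : {linear 'rV[R^c]_m -> 'rV[R^c]_q} := mulmxr gen_relations.

Fact gen_presented : finitely_presented (coker gen_map).
Proof.
exists m, q, gen_map, (coker_pi gen_map); split=> [x|v]; first exact: coker_pi_surj.
have -> : coker_pi gen_map v = 0 <-> coker_pi gen_map v = coker_pi gen_map 0.
  by rewrite linear0.
by rewrite coker_pi_eq subr0.
Qed.
Definition gen_module : fpmod R^c := FPMod gen_presented.

Let xi (j : 'I_q) : gen_module := coker_pi gen_map (delta_mx 0 j).
Definition ker_gen : tensor gen_module L := \sum_j tens1 (xi j) (y j).

Lemma tens_iotaE (X : lmodType R^c) (x : 'I_q -> X) :
  tens_map idfun iota (\sum_j tens1 (x j) (y j)) =
  \sum_l tens1 (\sum_j gen_relations l j *: x j) (delta_mx 0 l).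
Proof.
rewrite raddf_sum /=.
under [RHS]eq_bigr => l _ do rewrite tens1_suml.
rewrite exchange_big; apply: eq_bigr => j _ /=.
rewrite tens_map1 {1}(row_sum_delta (iota (y j))) tens1_sumr; apply: eq_bigr => l _.
by rewrite mxE tens1Z.
Qed.

Lemma ker_gen_map (X : lmodType R^c) (V : lmodType R) (h : {linear gen_module -> X})
    (l : {linear L -> V}) :
  tens_map h l ker_gen = \sum_j tens1 (h (xi j)) (l (y j)).
Proof. by rewrite raddf_sum; apply: eq_bigr => j _; rewrite /= tens_map1. Qed.

Lemma gen_mapE u j : gen_map u 0 j = \sum_l u 0 l * gen_relations l j.
Proof. by rewrite mxE. Qed.

Lemma gen_map_delta l : gen_map (delta_mx 0 l) = \sum_j gen_relations l j *: delta_mx 0 j.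
Proof.
rewrite [LHS]row_sum_delta; apply: eq_bigr => j _; congr (_ *: _).
by rewrite /= -rowE mxE.
Qed.

Lemma ker_gen_ker : tens_map idfun iota ker_gen = 0.
Proof.
rewrite tens_iotaE big1 // => l _; rewrite -[RHS](tens10l _ (delta_mx 0 l)); congr tens1.
have -> : \sum_j gen_relations l j *: xi j = coker_pi gen_map (gen_map (delta_mx 0 l)).
  by rewrite gen_map_delta linear_sum; apply: eq_bigr => j _; rewrite /= linearZ.
have -> : (0 : gen_module) = coker_pi gen_map 0 by rewrite linear0.
by apply/coker_pi_eq; exists (delta_mx 0 l); rewrite subr0.
Qed.

(** Coordinates in X (x) R^m are unique, so the hypothesis says that the x_j satisfy the defining
    relations of [gen_module]. *)
Lemma gen_lift (X : lmodType R^c) (x : 'I_q -> X) :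
  tens_map idfun iota (\sum_j tens1 (x j) (y j)) = 0 ->
  exists h : {linear gen_module -> X}, forall j, h (xi j) = x j.
Proof.
rewrite tens_iotaE => /tens_coord_r rel; have [h hE] := rV_comb x.
have h0 u : h (gen_map u) = 0.
  rewrite hE; under eq_bigr => j _ do rewrite gen_mapE scaler_suml.
  rewrite exchange_big big1 //= => l _.
  under eq_bigr => j _ do rewrite -scalerA.
  by rewrite -scaler_sumr rel scaler0.
by exists (coker_lift h0) => j; rewrite -(rV_comb_delta hE); exact: (coker_liftE h0).
Qed.

Lemma ker_gen_univ (X : lmodType R^c) (z : tensor X L) :
  tens_map idfun iota z = 0 ->
  exists h : {linear gen_module -> X}, z = tens_map h idfun ker_gen.
Proof.
have [x ->] := tens_span_r g_surj z => /gen_lift[h hE]; exists h.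
by rewrite (ker_gen_map _ idfun); apply: eq_bigr => j _; rewrite hE.
Qed.

Lemma eq_on_gens (V : lmodType R) (h k : {linear L -> V}) :
  (forall j, h (y j) = k (y j)) -> h =1 k.
Proof.
move=> hk z; have [v <-] := g_surj z; rewrite (row_sum_delta v) !linear_sum.
by apply: eq_bigr => j _; rewrite !linearZ /= hk.
Qed.

(** [gen_module] is a cokernel, so by right exactness sum_j e_j (x) l(y_j) is the image of some
    sum_k e_k (x) b_k in R^m (x) V. Set s(e_k) = b_k; comparing coordinates gives l(y_j) = s(iota
    y_j). *)
Lemma ker_gen_extend (V : lmodType R) (l : {linear L -> V}) :
  tens_map idfun l ker_gen = 0 -> exists s : {linear 'rV[R]_m -> V}, l =1 s \o iota.
Proof.
rewrite (ker_gen_map idfun l) => z0.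
have [w] : exists w : tensor 'rV[R^c]_m V,
    tens_map gen_map idfun w = \sum_j tens1 (delta_mx 0 j : 'rV[R^c]_q) (l (y j)).
  apply: (@tens_exact_l _ _ _ _ _ _ (coker_pi gen_map)) => [x|v v0|].
  - exact: coker_pi_surj.
  - have /coker_pi_eq[u uE] : coker_pi gen_map v = coker_pi gen_map 0 by rewrite v0 linear0.
    by exists u; rewrite uE subr0.
  - rewrite raddf_sum -[RHS]z0; apply: eq_bigr => j _.
    by rewrite /= tens_map1.
have [b ->] := @tens_span_l R m _ _ (idfun : {linear 'rV[R^c]_m -> _})
  (fun x => ex_intro _ x erefl) w.
have -> : tens_map gen_map idfun (\sum_k tens1 (delta_mx 0 k : 'rV[R^c]_m) (b k)) =
    \sum_j tens1 (delta_mx 0 j) (\sum_k (gen_relations k j : R) *: b k).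
  rewrite raddf_sum /=.
  under [RHS]eq_bigr => j _ do rewrite tens1_sumr.
  rewrite exchange_big; apply: eq_bigr => k _ /=.
  rewrite tens_map1 gen_map_delta tens1_suml; apply: eq_bigr => j _.
  by rewrite tens1Z.
move=> /tens_coord_l rel; have [s sE] := rV_comb b.
exists s; apply: eq_on_gens => j.
by rewrite /= sE -rel; apply: eq_bigr => k _; rewrite mxE.
Qed.

(** The value of theta at the universal element has the form sum_j xi_j (x) b_j, and l is to send
    y_j to b_j. What must be shown is that the b_j satisfy the relations of L, which [f]
    presents. *)
Lemma ker_gen_nat (t : nat) (f : {linear 'rV[R]_t -> 'rV[R]_q}) (F : functor R)
    (e : forall X : fpmod R^c, F X -> tensor X L) (V : lmodType R)
    (theta : forall X : fpmod R^c, F X -> tensor X V) :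
  (forall v, g v = 0 -> exists u, f u = v) -> (forall u, g (f u) = 0) ->
  ker_functor iota e -> (forall X : fpmod R^c, theta X 0 = 0) ->
  (forall (X Y : fpmod R^c) (h : {linear X -> Y}) x,
     theta Y (fun_map F h x) = tens_map h idfun (theta X x)) ->
  exists l : {linear L -> V}, forall X x, theta X x = tens_map idfun l (e X x).
Proof.
move=> gf gf0 eP theta0 theta_nat.
have e0 X := ker_functor0 X eP; case: eP => _ e_inj e_im e_nat.
have [x0 ex0] := (e_im gen_module _).1 ker_gen_ker.
have [b bE] := tens_span_l (@coker_pi_surj _ _ _ gen_map) (theta _ x0).
(* By naturality, a map that kills the universal element also kills its value under theta. *)
have kill (X : fpmod R^c) (h : {linear gen_module -> X}) :
    tens_map h idfun ker_gen = 0 -> \sum_j tens1 (h (xi j)) (b j) = 0.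
  move=> h0; have hx0 : fun_map F h x0 = 0 by apply: e_inj; rewrite e_nat ex0 h0 e0.
  have := theta_nat _ _ h x0; rewrite hx0 theta0 bE raddf_sum => {}h0; rewrite [RHS]h0.
  by apply: eq_bigr => j _; rewrite /= tens_map1.
(* [r k] is the k-th relation between the y_j. The free right module R^t tests all relations at
   once: x_j collects the coefficients of y_j in them, so the k-th coordinate of sum_j x_j (x) b_j
   is the k-th relation applied to the b_j. *)
pose r k j : R := f (delta_mx 0 k) 0 j.
pose x j := \sum_k (r k j : R^c) *: (delta_mx 0 k : 'rV[R^c]_t).
have sumE (W : lmodType R) (w : 'I_q -> W) :
    \sum_j tens1 (x j) (w j) = \sum_k tens1 (delta_mx 0 k) (\sum_j r k j *: w j).
  under eq_bigr => j _ do rewrite tens1_suml.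
  rewrite exchange_big; apply: eq_bigr => k _ /=.
  by rewrite tens1_sumr; apply: eq_bigr => j _; rewrite tens1Z.
have sum0 : \sum_j tens1 (x j) (y j) = 0.
  rewrite sumE big1 // => k _.
  have -> : \sum_j r k j *: y j = g (f (delta_mx 0 k)).
    by rewrite [f _]row_sum_delta linear_sum; apply: eq_bigr => j _; rewrite linearZ.
  by rewrite gf0 tens10r.
have rel k : \sum_j r k j *: b j = 0.
  have [|h hE] := @gen_lift (fp_free R^c t) x; first by rewrite sum0 raddf0.
  apply: (@tens_coord_l R t V (fun k => \sum_j r k j *: b j) (fun=> 0)).
  under [RHS]eq_bigr => i _ do rewrite tens10r.
  rewrite [RHS]big1 // -sumE -[RHS](kill _ h); first by apply: eq_bigr => j _; rewrite hE.
  by rewrite (ker_gen_map _ idfun) -[RHS]sum0; apply: eq_bigr => j _; rewrite hE.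
have [s sE] := rV_comb b.
have sf u : s (f u) = 0.
  rewrite (row_sum_delta u) !linear_sum big1 // => k _.
  by rewrite !linearZ /= sE rel scaler0.
have [gi giE] := choice g_surj.
have gs w w' : g w = g w' -> s w = s w'.
  move=> /eqP; rewrite -subr_eq0 -linearB => /eqP/gf[u uE].
  by apply/eqP; rewrite -subr_eq0 -linearB -uE sf.
have ll : linear (s \o gi).
  by move=> a u v /=; rewrite -linearP; apply: gs; rewrite linearP !giE.
exists (lin_of ll) => X a.
(* Every element is the image of [x0] under some h, so naturality reduces the claim to [x0]. *)
have [h hE] := ker_gen_univ ((e_im _ _).2 (ex_intro _ a erefl)).
have -> : a = fun_map F h x0 by apply: e_inj; rewrite hE e_nat ex0.
rewrite theta_nat e_nat ex0 tens_map_comp ker_gen_map bE raddf_sum.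
apply: eq_bigr => j _; rewrite /= tens_map1; congr tens1.
by rewrite /= -(rV_comb_delta sE); apply: gs; rewrite giE.
Qed.
End KernelGenerator.

Lemma projective_split (R : pzRingType) (W : lmodType R) m (g : {linear 'rV[R]_m -> W}) :
  projective W -> (forall w, exists v, g v = w) ->
  exists s : {linear W -> 'rV[R]_m}, cancel s g.
Proof. by move=> pW gs; exact: (pW _ _ g idfun gs). Qed.

(** * Passing from free to projective targets *)

Section KernelOfProjective.
Variables (R : pzRingType) (L W : fpmod R) (i : {linear L -> W}).
Hypothesis projW : projective W.

(** A split injection remains one after tensoring, so composing i with the section of W into R^m
    leaves the kernel unchanged. *)
Let ker_split m (g : {linear 'rV[R]_m -> W}) (s : {linear W -> 'rV[R]_m})
    (X : lmodType R^c) (z : tensor X L) :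
  cancel s g -> tens_map idfun (s \o i) z = 0 <-> tens_map idfun i z = 0.
Proof.
move=> sK; rewrite tens_map_compr; split=> [z0|->]; last by rewrite raddf0.
rewrite -[RHS](raddf0 (tens_map (idfun : {linear X -> X}) g)) -z0 /= !tens_map_comp.
by apply: tens_map_ext => // y; rewrite /= sK.
Qed.

Lemma ker_tens_extend (V : lmodType R) (l : {linear L -> V}) :
  (forall (X : fpmod R^c) (z : tensor X L), tens_map idfun i z = 0 -> tens_map idfun l z = 0) ->
  exists s : {linear W -> V}, l =1 s \o i.
Proof.
move=> kl; have [_ [m [_ [g [g_surj _]]]]] := fp_presented W.
have [_ [q [_ [gL [gL_surj _]]]]] := fp_presented L.
have [s sK] := projective_split projW g_surj.
have [|t tE] := ker_gen_extend (iota := s \o i) gL_surj (l := l).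
  by apply: kl; apply/(ker_split _ sK); apply: ker_gen_ker.
by exists (t \o s).
Qed.

Lemma ker_functor_nat (F : functor R) (e : forall X : fpmod R^c, F X -> tensor X L)
    (V : lmodType R) (theta : forall X : fpmod R^c, F X -> tensor X V) :
  ker_functor i e -> (forall X : fpmod R^c, theta X 0 = 0) ->
  (forall (X Y : fpmod R^c) (h : {linear X -> Y}) x,
     theta Y (fun_map F h x) = tens_map h idfun (theta X x)) ->
  exists l : {linear L -> V}, forall X x, theta X x = tens_map idfun l (e X x).
Proof.
move=> [eD e_inj e_im e_nat]; have [_ [m [_ [g [g_surj _]]]]] := fp_presented W.
have [t [q [f [gL [gL_surj ex]]]]] := fp_presented L.
have [s sK] := projective_split projW g_surj.
apply: (@ker_gen_nat R L q m gL (s \o i) gL_surj t f) => [v /ex//|u|].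
  by apply/ex; exists u.
by split=> // X z; rewrite (ker_split _ sK).
Qed.
End KernelOfProjective.

(** * Tor and syzygies *)

Definition nat_iso (R : pzRingType) (F G : functor R) : Prop :=
  exists s : nat_trans F G, forall X : fpmod R^c, bijective (s X).

Lemma ker_functor_iso (R : pzRingType) (L V : lmodType R) (i : {linear L -> V})
    (F G : functor R) (e : forall X : fpmod R^c, G X -> tensor X L) :
  nat_iso F G -> ker_functor i e ->
  exists e' : forall X : fpmod R^c, F X -> tensor X L, ker_functor i e'.
Proof.
move=> [s s_bij] [eD e_inj e_im e_nat]; exists (fun X x => e X (s X x)); split.
- by move=> X x y /=; rewrite nt_add eD.
- by move=> X; apply: inj_comp => //; apply: bij_inj.
- move=> X z; have [s' sK s'K] := s_bij X; rewrite e_im; split=> -[x <-].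
    by exists (s' x); rewrite s'K.
  by exists (s X x).
- by move=> X Y h x; rewrite nt_natural e_nat.
Qed.

Lemma functor_eq (R : pzRingType) (obj : fpmod R^c -> zmodType)
    (map : forall X Y : fpmod R^c, {linear X -> Y} -> {additive obj X -> obj Y})
    id1 id2 comp1 comp2 :
  @Functor R obj map id1 comp1 = @Functor R obj map id2 comp2.
Proof. by rewrite (Prop_irrelevance id1 id2) (Prop_irrelevance comp1 comp2). Qed.

(** * Dimension shifting along a conflation *)

Section ResolutionCons.
Variables (R : pzRingType) (L K : fpmod R) (c : conflation L K) (S : resolution L).
Hypothesis projc : projective (cf_mid c).

Definition cons_obj k : lmodType R :=
  match k with 0 => fp_sort (cf_mid c) | k'.+1 => res_obj S k' end.
Definition cons_d k : {linear cons_obj k.+1 -> cons_obj k} :=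
  match k with 0 => cf_inj c \o res_aug S | k'.+1 => res_d S k' end.
Fact cons_proj k : projective (cons_obj k).
Proof. by case: k => [|k] //=; apply: res_proj. Qed.
Fact cons_exact0 x : cf_proj c x = 0 <-> exists y, cons_d 0 y = x.
Proof.
rewrite cf_exact; split=> [[b <-]|[y <-]]; last by exists (res_aug S y).
by have [y <-] := res_augP S b; exists y.
Qed.
Fact cons_exactS k x : cons_d k x = 0 <-> exists y, cons_d k.+1 y = x.
Proof.
case: k x => [|k] /= x; last exact: res_exactS.
rewrite -res_exact0 /=; split=> [ix0|->]; last by rewrite linear0.
by apply: (@cf_injP _ _ _ c); rewrite ix0 linear0.
Qed.
Definition res_cons : resolution K :=
  Resolution cons_proj (cf_projP c) cons_exact0 cons_exactS.

(** In these degrees both complexes are the same by computation. The shift starts at degree 1 of S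
    because the differential of S leaving degree 0 is zero, unlike [cons_d 0]. *)
Lemma Tor_res_cons k : Tor res_cons k.+2 = Tor S k.+1.
Proof. exact: functor_eq. Qed.

(** The augmentation of S induces the embedding: by right exactness it identifies X (x) L with X (x)
    S_0 modulo boundaries, and the cycles are the elements whose image in X (x) L dies in the middle
    term. *)
Lemma Tor1_ker_functor :
  exists e : forall X : fpmod R^c, Tor res_cons 1 X -> tensor X L,
    ker_functor (cf_inj c) e.
Proof.
pose aug (X : lmodType R^c) : {additive tensor X (res_obj S 0) -> tensor X L} :=
  tens_map idfun (res_aug S).
pose e (X : fpmod R^c) (x : Tor res_cons 1 X) := aug X (val (repr x)).
have eE (X : fpmod R^c) z : e X (hclass (tor_in res_cons X 1) z) = aug X (val z).
  have /hclass_eq[a ae] : hclass (tor_in res_cons X 1) (repr (hclass (tor_in res_cons X 1) z)) =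
    hclass (tor_in res_cons X 1) z by rewrite /hclass reprK.
  apply/eqP; rewrite -subr_eq0 -raddfB -ae /= tens_map_comp.
  rewrite (tens_map_ext _ (f' := idfun) (g' := \0)) ?tens_map0r // => y /=.
  by apply/res_exact0; exists y.
have outE (X : fpmod R^c) (z : tensor X (res_obj S 0)) :
    tor_out res_cons X 1 z = tens_map idfun (cf_inj c) (aug X z).
  exact: tens_map_compr.
exists e; split.
- move=> X x y; suff eB u v : e X (u - v) = e X u - e X v.
    by apply/eqP; rewrite -subr_eq -eB addrK.
  case: (hclass_surj u) => u' <-; case: (hclass_surj v) => v' <-.
  by rewrite -hclassB !eE !raddfB.
- move=> X x y; case: (hclass_surj x) => u <-; case: (hclass_surj y) => v <-.
  rewrite !eE => /eqP; rewrite -subr_eq0 -raddfB => /eqP.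
  move=> /(tens_exact_r (res_augP S) (fun v => (res_exact0 v).1))[w wE].
  by apply/hclass_eq; exists w.
- move=> X z; split=> [z0|[x <-]].
    have [x xE] := tens_map_surj (f := (idfun : {linear X -> X})) (fun x => ex_intro _ x erefl)
      (res_augP S) z.
    have xk : x \in ker_pred (tor_out res_cons X 1).
      by rewrite unfold_in outE /aug /= xE z0.
    by exists (hclass (tor_in res_cons X 1) (Sub x xk)); rewrite eE.
  case: (hclass_surj x) => -[u uk] <-; rewrite eE /= -outE.
  by apply/eqP.
- move=> X Y h x; case: (hclass_surj x) => u <-.
  rewrite /= /tor_map /= hmapE !eE /=.
  by rewrite /aug !tens_map_comp; apply: tens_map_ext.
Qed.
End ResolutionCons.

(** Builds chain maps and homotopies degree by degree; [good] is the condition that allows the next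
    step. *)
Lemma dep_choice (T : nat -> Type) (good : forall k, T k -> Prop)
    (step : forall k, T k -> T k.+1 -> Prop) (t0 : T 0%N) :
  good 0%N t0 -> (forall k t, good k t -> exists t', step k t t' /\ good k.+1 t') ->
  exists f : forall k, T k, f 0%N = t0 /\ forall k, step k (f k) (f k.+1).
Proof.
move=> g0 ex.
have nxt k (t : {t : T k | good k t}) :
    {t' : {t' : T k.+1 | good k.+1 t'} | step k (sval t) (sval t')}.
  by case: t => t gt; have [t' [st gt']] := cid (ex k t gt); exists (exist _ t' gt').
pose f := fix f k : {t : T k | good k t} :=
  match k with 0 => exist _ t0 g0 | k'.+1 => sval (nxt k' (f k')) end.
by exists (fun k => sval (f k)); split=> // k; apply: (svalP (nxt k (f k))).
Qed.

(** * Comparison of projective resolutions *)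

Section Comparison.
Variable R : pzRingType.

(** Projectivity lifts along surjections, so d and f are first corestricted to the kernel of d'. *)
Lemma projective_lift_exact (W U V Z : lmodType R) (d : {linear U -> V})
    (d' : {linear V -> Z}) (f : {linear W -> V}) :
  projective W -> (forall v, d' v = 0 <-> exists u, d u = v) ->
  (forall w, d' (f w) = 0) -> exists g : {linear W -> U}, forall w, d (g w) = f w.
Proof.
move=> projW ex d'f.
have dk u : d u \in ker_pred d' by rewrite unfold_in; apply/eqP/ex; exists u.
have fk w : f w \in ker_pred d' by rewrite unfold_in d'f.
have dl : linear (fun u => Sub (d u) (dk u) : Defs.lker d').
  by move=> a u v; apply: val_inj; rewrite [RHS]linearP /= linearP.
have fl : linear (fun w => Sub (f w) (fk w) : Defs.lker d').
  by move=> a u v; apply: val_inj; rewrite [RHS]linearP /= linearP.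
have [[v vk]|g gE] := projW _ _ (lin_of dl) (lin_of fl).
  have /ex[u uE] : d' v = 0 by apply/eqP.
  by exists u; apply: val_inj.
by exists g => w; have /(congr1 val) := gE w.
Qed.

Definition chain_map (M M' : lmodType R) (P : resolution M) (P' : resolution M')
    (f : forall k, {linear res_obj P k -> res_obj P' k}) : Prop :=
  forall k x, res_d P' k (f k.+1 x) = f k (res_d P k x).

Lemma chain_map_exists (M : lmodType R) (P P' : resolution M) :
  exists f : forall k, {linear res_obj P k -> res_obj P' k},
    chain_map f /\ forall x, res_aug P' (f 0%N x) = res_aug P x.
Proof.
have [f0 f0E] := @res_proj _ _ P 0 _ _ (res_aug P') (res_aug P) (res_augP P').
(* The next component exists once f d is killed by the following differential of P', which is the
   augmentation in degree 0. *)
pose good k : {linear res_obj P k -> res_obj P' k} -> Prop :=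
  match k with
  | 0 => fun f => forall x, res_aug P' (f (res_d P 0 x)) = 0
  | k'.+1 => fun f => forall x, res_d P' k' (f (res_d P k'.+1 x)) = 0
  end.
pose step k (f : {linear res_obj P k -> res_obj P' k})
    (f' : {linear res_obj P k.+1 -> res_obj P' k.+1}) :=
  forall x, res_d P' k (f' x) = f (res_d P k x).
have dd k x : res_d P k (res_d P k.+1 x) = 0 by apply/res_exactS; exists x.
have [x|k f gf|f [f0f fs]] := @dep_choice _ good step f0.
- by rewrite f0E; apply/res_exact0; exists x.
- have [f' f'E] : exists f' : {linear res_obj P k.+1 -> res_obj P' k.+1}, step k f f'.
    case: k f gf => [|k] f gf; apply: (projective_lift_exact (f := f \o res_d P _)) gf.
    + exact: res_proj.
    + exact: res_exact0.
    + exact: res_proj.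
    + exact: res_exactS.
  by exists f'; split=> // x; rewrite f'E dd linear0.
- by exists f; split=> // x; rewrite f0f.
Qed.

(** The homotopy formula is stated in positive degrees, those that enter Tor in degree k+1. *)
Lemma chain_homotopy_exists (M : lmodType R) (P P' : resolution M)
    (h : forall k, {linear res_obj P k -> res_obj P' k}) :
  chain_map h -> (forall x, res_aug P' (h 0%N x) = 0) ->
  exists s : forall k, {linear res_obj P k -> res_obj P' k.+1},
    forall k x, h k.+1 x = res_d P' k.+1 (s k.+1 x) + s k (res_d P k x).
Proof.
move=> hd h0.
have [s0 s0E] := projective_lift_exact (@res_proj _ _ P 0) (@res_exact0 _ _ P') h0.
have dd k x : res_d P k (res_d P k.+1 x) = 0 by apply/res_exactS; exists x.
pose good k (s : {linear res_obj P k -> res_obj P' k.+1}) :=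
  forall x, res_d P' k (h k.+1 x - s (res_d P k x)) = 0.
pose step k (s : {linear res_obj P k -> res_obj P' k.+1})
    (s' : {linear res_obj P k.+1 -> res_obj P' k.+2}) :=
  forall x, h k.+1 x = res_d P' k.+1 (s' x) + s (res_d P k x).
have [x|k s gs|s [_ ss]] := @dep_choice _ good step s0; last by exists s.
  by rewrite linearB /= hd s0E subrr.
have [s' s'E] := projective_lift_exact (f := h k.+1 \- (s \o res_d P k))
  (@res_proj _ _ P k.+1) (@res_exactS _ _ P' k) gs.
exists s'; split=> x; rewrite ?s'E /= ?subrK //.
by rewrite linearB /= hd s'E /= dd linear0 subr0 subrr.
Qed.

Lemma chain_map_Tor (M M' : lmodType R) (P : resolution M) (P' : resolution M')
    (f : forall k, {linear res_obj P k -> res_obj P' k}) k :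
  chain_map f -> exists s : nat_trans (Tor P k.+1) (Tor P' k.+1),
    forall (X : fpmod R^c) z, exists2 z',
      s X (hclass (tor_in P X k.+1) z) = hclass (tor_in P' X k.+1) z' &
      val z' = tens_map idfun (f k.+1) (val z).
Proof.
move=> fd.
pose tf (X : lmodType R^c) j : {additive tensor X (res_obj P j) -> tensor X (res_obj P' j)} :=
  tens_map idfun (f j).
have hd (X : lmodType R^c) j b :
    tf X j (tens_map idfun (res_d P j) b) = tens_map idfun (res_d P' j) (tf X j.+1 b).
  by rewrite /tf /= !tens_map_comp; apply: tens_map_ext => // x /=; rewrite fd.
pose s (X : fpmod R^c) : {additive Tor P k.+1 X -> Tor P' k.+1 X} :=
  hmap (f := tor_in P X k.+1) (g := tor_out P X k.+1) (f' := tor_in P' X k.+1)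
    (g' := tor_out P' X k.+1) (hC := tf X k) (hd X k) (hd X k.+1).
have sN (X Y : fpmod R^c) (h : {linear X -> Y}) x :
    s Y (fun_map (Tor P k.+1) h x) = fun_map (Tor P' k.+1) h (s X x).
  case: (hclass_surj x) => z <-; rewrite /= /tor_map /s /= !hmapE; congr hclass.
  by apply: val_inj; rewrite /= /tf /= !tens_map_comp.
exists (NatTrans (fun X => raddfD (s X)) sN) => X z.
by rewrite /= /s /= hmapE; eexists; first reflexivity.
Qed.

Lemma chain_homotopic_Tor (M : lmodType R) (P P' : resolution M)
    (f : forall k, {linear res_obj P k -> res_obj P' k})
    (g : forall k, {linear res_obj P' k -> res_obj P k}) k
    (s : nat_trans (Tor P k.+1) (Tor P' k.+1)) (t : nat_trans (Tor P' k.+1) (Tor P k.+1)) :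
  chain_map f -> chain_map g ->
  (forall x, res_aug P' (f 0%N x) = res_aug P x) ->
  (forall x, res_aug P (g 0%N x) = res_aug P' x) ->
  (forall (X : fpmod R^c) z, exists2 z',
      s X (hclass (tor_in P X k.+1) z) = hclass (tor_in P' X k.+1) z' &
      val z' = tens_map idfun (f k.+1) (val z)) ->
  (forall (X : fpmod R^c) z, exists2 z',
      t X (hclass (tor_in P' X k.+1) z) = hclass (tor_in P X k.+1) z' &
      val z' = tens_map idfun (g k.+1) (val z)) ->
  forall X, cancel (s X) (t X).
Proof.
move=> fd gd f0 g0 sE tE X x; case: (hclass_surj x) => z <-.
have [z1 -> z1E] := sE X z; have [z2 -> z2E] := tE X z1.
have [||u uE] := @chain_homotopy_exists M P P (fun k => (g k \o f k) \- idfun).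
- by move=> j y; rewrite /= linearB /= gd fd.
- by move=> y; rewrite linearB /= g0 f0 subrr.
(* From g f - 1 = d u + u d and d z = 0, the difference g f z - z is the boundary of u z. *)
apply/hclass_eq; exists (tens_map idfun (u k.+1) (val z)).
have zk : tens_map idfun (res_d P k) (val z) = 0 by apply/eqP; case: z {z1E}.
rewrite z2E z1E tens_map_comp.
have -> : tens_map (idfun \o idfun) (g k.+1 \o f k.+1) (val z) =
    tens_map idfun ((res_d P k.+1 \o u k.+1) \+ (u k \o res_d P k) \+ idfun) (val z).
  by apply: tens_map_ext => // y /=; rewrite -uE /= subrK.
rewrite !tens_map_add tens_map_id addrK.
rewrite /tor_in /= tens_map_comp -[LHS]addr0; congr (_ + _).
rewrite -(raddf0 (tens_map (idfun : {linear X -> X}) (u k))) -zk /= tens_map_comp.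
exact: tens_map_ext.
Qed.

Lemma Tor_iso (M : lmodType R) (P P' : resolution M) k :
  nat_iso (Tor P k.+1) (Tor P' k.+1).
Proof.
have [f [fd f0]] := chain_map_exists P P'; have [g [gd g0]] := chain_map_exists P' P.
have [s sE] := chain_map_Tor k fd; have [t tE] := chain_map_Tor k gd.
exists s => X; exists (t X); exact: chain_homotopic_Tor.
Qed.
End Comparison.

(** * Tor in degree n+1 as a kernel functor on a syzygy *)

Section Syzygy.
Variable R : pzRingType.
Hypothesis hR : enough_projectives R.
Implicit Types K L M W : fpmod R.

(** Lifting the identity along a conflation with projective middle term makes W a retract of a
    module that is projective among all modules. *)
Lemma fp_projective_projective W : fp_projective W -> projective W.
Proof.
have [K [c projc]] := hR W => /(_ _ _ c idfun)[s sK] U V p f p_surj.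
have [g gE] := projc _ _ p (f \o cf_proj c) p_surj.
by exists (g \o s) => w; rewrite /= gE /= sK.
Qed.

Lemma resolution_exists M : inhabited (resolution M).
Proof.
have [Om OmP] := choice (hR : forall A : fpmod R, exists K,
  exists c : conflation K A, projective (cf_mid c)).
pose c A := sval (cid (OmP A)); have cP A : projective (cf_mid (c A)) := svalP (cid (OmP A)).
pose A k := iter k Om M; pose obj k : lmodType R := cf_mid (c (A k)).
pose d k : {linear obj k.+1 -> obj k} := cf_inj (c (A k)) \o cf_proj (c (A k.+1)).
have ex0 x : cf_proj (c M) x = 0 <-> exists y, d 0%N y = x.
  rewrite cf_exact; split=> [[b <-]|[y <-]]; last by exists (cf_proj (c (A 1%N)) y).
  by have [y <-] := cf_projP (c (A 1%N)) b; exists y.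
have exS k x : d k x = 0 <-> exists y, d k.+1 y = x.
  have -> : d k x = 0 <-> cf_proj (c (A k.+1)) x = 0.
    split=> [/= d0|/= ->]; last by rewrite linear0.
    by apply: (@cf_injP _ _ _ (c (A k))); rewrite d0 linear0.
  rewrite cf_exact; split=> [[b <-]|[y <-]]; last by exists (cf_proj (c (A k.+2)) y).
  by have [y <-] := cf_projP (c (A k.+2)) b; exists y.
by split; exact: (Resolution (fun k => cP (A k)) (cf_projP (c M)) ex0 exS).
Qed.

(** P is S spliced onto the projective terms of the syzygy sequence. S is generalised in the
    induction, since each step prepends one of these terms to it. *)
Lemma Tor_syzygy n M K (S : resolution K) : is_syzygy M n K ->
  exists P : resolution M, forall k, Tor P (n + k).+1 = Tor S k.+1.
Proof.
move=> MK; elim: MK S => {n K} [|n K L c _ IH /fp_projective_projective pc] S; first by exists S.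
have [P PE] := IH (res_cons S pc); exists P => k.
by rewrite addSnnS PE Tor_res_cons.
Qed.

(** The given resolution is compared with one that passes through c, for which Tor in degree n+1
    equals Tor in degree 1 of K. *)
Lemma Tor_ker_functor n M K L (c : conflation L K) (P : resolution M) :
  is_syzygy M n K -> projective (cf_mid c) ->
  exists e : forall X : fpmod R^c, Tor P n.+1 X -> tensor X L, ker_functor (cf_inj c) e.
Proof.
move=> MK pc; have [S] := resolution_exists L.
have [P' /(_ 0%N)] := Tor_syzygy (res_cons S pc) MK; rewrite addn0 => P'E.
have [e eP] := Tor1_ker_functor S pc; rewrite -P'E in e eP.
exact: ker_functor_iso (Tor_iso P P' n) eP.
Qed.
End Syzygy.

(** * Stable maps and natural transformations *)

Section InducedNat.
Variables (R : pzRingType) (K K' L L' : fpmod R).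
Variables (c : conflation L K) (c' : conflation L' K').
Variables (F F' : functor R).
Variables (e : forall X : fpmod R^c, F X -> tensor X L).
Variables (e' : forall X : fpmod R^c, F' X -> tensor X L').
Hypotheses (pc : projective (cf_mid c)) (pc' : projective (cf_mid c')).
Hypotheses (eP : ker_functor (cf_inj c) e) (eP' : ker_functor (cf_inj c') e').

(** A relation, because the lift l is determined by f only up to maps that extend over the middle
    term of c. *)
Definition induces (f : {linear K -> K'}) (s : nat_trans F F') : Prop :=
  exists l : {linear L -> L'}, cf_mor l f c c' /\
    forall X x, e' (s X x) = tens_map idfun l (e x).

Lemma ker_functor_ker (X : fpmod R^c) (x : F X) : tens_map idfun (cf_inj c) (e x) = 0.
Proof. by apply/(kf_im eP); exists x. Qed.

Lemma tens_map_ker_factor (X : lmodType R^c) (V : lmodType R) (l : {linear L -> V})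
    (u : {linear cf_mid c -> V}) (z : tensor X L) :
  l =1 u \o cf_inj c -> tens_map idfun (cf_inj c) z = 0 -> tens_map idfun l z = 0.
Proof.
move=> lu z0; rewrite (tens_map_ext _ (f' := idfun) (g' := u \o cf_inj c)) //.
by rewrite tens_map_compr z0 raddf0.
Qed.

Lemma induces_total f : exists s, induces f s.
Proof.
have [l lf] := cf_mor_lift c' f (projective_fp pc).
have [h [h1 _]] := lf.
have ex (X : fpmod R^c) (x : F X) : exists y, e' y = tens_map idfun l (e x).
  apply/(kf_im eP'); rewrite -tens_map_compr.
  by apply: (tens_map_ker_factor (u := h)) (ker_functor_ker _) => b /=; rewrite h1.
pose s (X : fpmod R^c) (x : F X) := sval (cid (ex X x)).
have sE X x : e' (s X x) = tens_map idfun l (e x) := svalP (cid (ex X x)).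
have sD (X : fpmod R^c) : {morph s X : x y / x + y}.
  by move=> x y; apply: (kf_inj eP'); rewrite (kf_add eP') !sE (kf_add eP) raddfD.
have sN (X Y : fpmod R^c) (g : {linear X -> Y}) x : s Y (fun_map F g x) = fun_map F' g (s X x).
  apply: (kf_inj eP'); rewrite (kf_nat eP') !sE (kf_nat eP) !tens_map_comp.
  exact: tens_map_ext.
by exists (NatTrans sD sN), l.
Qed.

(** The transformation comes from some l : L -> L'. Followed by [cf_inj c'], this l vanishes on the
    kernels, so it extends to a map h of middle terms, and h descends to f on the cokernels. *)
Lemma induces_surj s : exists f, induces f s.
Proof.
have [||l lE] := ker_functor_nat (theta := fun X x => e' (s X x)) pc eP.
- move=> X /=; rewrite -[RHS](ker_functor0 X eP'); congr e'.
  by apply: (@addIr _ (s X 0)); rewrite -nt_add !add0r.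
- by move=> X Y h x; rewrite nt_natural (kf_nat eP').
have [h hE] : exists h : {linear cf_mid c -> cf_mid c'}, cf_inj c' \o l =1 h \o cf_inj c.
  apply: (ker_tens_extend pc) => X z /(kf_im eP)[x <-].
  rewrite tens_map_compr -lE; apply/(kf_im eP').
  by exists (s X x).
have [b|f fE] := cf_descend (x := c) (h := cf_proj c' \o h).
  by have /= <- := hE b; rewrite cf_projK.
exists f, l; split; last by move=> X x; rewrite lE.
by exists h; split=> [b|w]; [rewrite -[LHS](hE b) | rewrite fE].
Qed.

Lemma induces_eq f f' s s' : induces f s -> induces f' s' ->
  s = s' <-> proj_factoring (f \- f').
Proof.
move=> [l [lf lE]] [l' [lf' lE']]; have mor := cf_mor_sub lf lf'; split=> [ss'|].
  (* Equal transformations make l - l' vanish on the kernels, so it extends to some u. Then h -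
     [cf_inj c'] u kills L and descends to a lift of f - f' to the projective middle term of c'. *)
  have [u uE] : exists u : {linear cf_mid c -> L'}, l \- l' =1 u \o cf_inj c.
    apply: (ker_tens_extend pc) => X z /(kf_im eP)[x <-].
    by rewrite tens_map_sub -lE -lE' ss' subrr.
  have [h [h1 h2]] := mor.
  have [b|k kE] := cf_descend (x := c) (h := h \- (cf_inj c' \o u)).
    by rewrite /= h1 -[u _](uE b) subrr.
  exists (cf_mid c'), k, (cf_proj c'); split; first exact: projective_fp.
  move=> a; have [w <-] := cf_projP c a.
  by rewrite /= kE /= linearB h2 cf_projK subr0.
(* Lifting v to the middle term of c' yields a morphism over f - f' with zero left end. Subtracting
   it leaves l - l' over zero, so l - l' extends over the middle term of c and vanishes on the
   kernels. *)
move=> [W [u [v [pW fE]]]]; have [w wE] := pW _ _ c' v.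
have mor0 : cf_mor \0 (f \- f') c c'.
  exists (w \o (u \o cf_proj c)); split=> [b|a] /=; first by rewrite cf_projK !linear0.
  by rewrite wE -[v _](fE _).
have [|t tE] := @cf_mor0_extend _ _ _ _ _ c c' (l \- l').
  by apply: cf_mor_ext (cf_mor_sub mor mor0) => a /=; rewrite ?subr0 ?subrr.
apply: nat_transP => X x; apply: (kf_inj eP'); rewrite lE lE'.
apply/eqP; rewrite -subr_eq0 -tens_map_sub; apply/eqP.
exact: tens_map_ker_factor tE (ker_functor_ker x).
Qed.

Lemma induces_add f f' s s' : induces f s -> induces f' s' ->
  induces (f \+ f') (nt_plus s s').
Proof.
move=> [l [[h [h1 h2]] lE]] [l' [[h' [h1' h2']] lE']]; exists (l \+ l'); split.
  by exists (h \+ h'); split=> [b|w] /=; rewrite linearD ?h1 ?h1' ?h2 ?h2'.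
by move=> X x; rewrite (kf_add eP') lE lE' tens_map_add.
Qed.
End InducedNat.

Theorem corollary3p11 (R : pzRingType) (hR : enough_projectives R) (n : nat)
    (M N Om : fpmod R) (hOm : is_syzygy N n Om)
    (P : resolution (fp_sort M)) (Q : resolution (fp_sort N)) :
  group_iso (quot_group (proj_factor_group n M Om)) (Nat (Tor P n.+1) (Tor Q n.+1)).
Proof.
have [K [eps [MK epsP]]] := syzygy_ext_exists n M hR.
(* One syzygy beyond the n-th ones, since Tor in degree n+1 is Tor in degree 1 of an n-th syzygy. *)
have [L [c pc]] := hR K; have [L' [c' pc']] := hR Om.
have [e eP] := Tor_ker_functor hR P MK pc.
have [e' eP'] := Tor_ker_functor hR Q hOm pc'.
pose cls (f : {linear K -> Om}) : quot_group (proj_factor_group n M Om) :=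
  qpi (coset_eqrel (proj_factor_group n M Om)) (ext_cls eps f).
(* A class and a transformation correspond when one map f : K -> Om represents both. *)
apply: (@group_iso_rel (quot_group (proj_factor_group n M Om))
  (Nat (Tor P n.+1) (Tor Q n.+1)) (fun x s => exists f, x = cls f /\ induces c c' e e' f s)).
- move=> x; case: (qpi_surj x) => y <-; have [f ->] := ext_cls_surj epsP y.
  by have [s fs] := induces_total pc eP eP' f; exists s, f.
- by move=> s; have [f fs] := induces_surj pc eP eP' s; exists (cls f), f.
- move=> _ _ s s' [f [-> fs]] [f' [-> fs']].
  by rewrite (induces_eq pc pc' eP eP' fs fs') -(ext_cls_eq epsP).
- move=> _ _ s s' [f [-> fs]] [f' [-> fs']]; exists (f \+ f'); split.
    by rewrite /cls ext_clsD; apply: quot_addE.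
  by have := induces_add eP' fs fs'.
Qed.
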